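(* Let $(X,T)$ be a minimal Cantor system given by a proper and clean Bratteli-Vershik representation of Toeplitz type, of rank $d$ and with characteristic sequence $(q_n; n\ge 1)$. Let $\mathcal M_{erg}(X,T)$ be the set of ergodic $T$-invariant probability measures. For $\mu\in\mathcal M_{erg}(X,T)$ let $$\mathbf B_\mu=\Big\{\lim_{m\to\infty} \tfrac{b}{\gcd(b,p_m)}\ :\ b\in\mathbb N,\ \exp(2i\pi/b)\text{ is a non continuous eigenvalue of }(X,T)\text{ for }\mu\Big\},$$ ordered by divisibility, and let $\mathcal M=\{\mu\in\mathcal M_{erg}(X,T): \mathbf B_\mu\ne\emptyset\}$. Then: (1) for any $\mu\in\mathcal M$ and $\mathbf b\in\mathbf B_\mu$, $\mathbf b\le \#I_\mu$; (2) for any $\mu\in\mathcal M$, $\mathbf B_\mu$ has a unique divisibility-maximal element, denoted $\mathbf b_\mu$; (3) $\sum_{\mu\in\mathcal M}\mathbf b_\mu\le d$; (4) $\#\mathcal M\le \#\mathcal M_{erg}(X,T)\le d-\sum_{\mu\in\mathcal M}(\mathbf b_\mu-1)$.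
   Context: Bratteli diagrams. A Bratteli diagram is an infinite graph $(V,E)$ with $V=V_0\cup V_1\cup\cdots$, $E=E_1\cup E_2\cup\cdots$ (disjoint finite levels), $V_0=\{v_0\}$, edges of $E_n$ going from $V_{n-1}$ to $V_n$, every vertex of $V_n$ being the end-point of some edge of $E_n$ ($n\ge1$) and the initial point of some edge of $E_{n+1}$ ($n\ge 0$). $M_n$ is the $V_{n-1}\times V_n$ matrix whose $(t_1,t_2)$ entry is the number of edges of $E_n$ from $t_1$ to $t_2$. $h_n(t)$ is the number of paths from $v_0$ to $t\in V_n$. An ordered diagram carries a partial order $\preceq$ on $E$ in which two edges are comparable iff they have the same end-point. $X$ is the space of infinite paths $x=(x_1,x_2,\dots)$ from $v_0$ (with the topology generated by cylinders, assumed a Cantor set). The diagram is properly ordered if there is a unique infinite path $x_{\max}$ all of whose edges are maximal and a unique one $x_{\min}$ all of whose edges are minimal; then the Vershik map $T$ sends $x\ne x_{\max}$ to $(y_1,\dots,y_{n-1},y_n,x_{n+1},\dots)$, where $n$ is least with $x_n$ not maximal, $y_n$ is the successor of $x_n$, and $(y_1,\dots,y_{n-1})$ is the minimal path (all edges minimal) from $v_0$ to the initial vertex of $y_n$; and $T x_{\max}=x_{\min}$. A (Bratteli-Vershik) representation of a system is such a diagram whose Vershik system is conjugate to it; the system is identified with the Vershik system $(X,T)$. Proper, of rank $d$: the diagram is properly ordered and (H1) $h_1(t)=1$ for all $t\in V_1$; (H2) $M_n>0$ entrywise for $n\ge2$; (H3) $\#V_n=d$ for all $n\geq 1$, and $V_n$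 is identified with $\{1,\dots,d\}$; (H4) for every $n\ge2$ all maximal edges of $E_n$ start at the same vertex of $V_{n-1}$. Toeplitz type: for each $n\ge1$ the number $q_n$ of edges of $E_n$ ending at a vertex of $V_n$ does not depend on the vertex. $(q_n;n\ge1)$ is the characteristic sequence and $p_n=q_1\cdots q_n$. For $b\in\mathbb N$ the sequence $b/\gcd(b,p_m)$ is eventually constant, so the limit above exists. $\tau_n(x)\in V_n$ is the vertex of level $n$ through which the path $x$ passes. Clean: there is $\delta>0$ such that for each ergodic invariant probability measure $\mu$ there is a set $I_\mu\subseteq\{1,\dots,d\}$ with $\mu(\tau_n=t)\ge\delta$ for all $t\in I_\mu$, $n\ge1$, and $\lim_{n\to\infty}\mu(\tau_n=t)=0$ for $t\notin I_\mu$; and $I_\mu\cap I_\nu=\emptyset$ for distinct ergodic $\mu,\nu$. Eigenvalues: $\lambda\in\mathbb C$ is an eigenvalue of $(X,T)$ for $\mu$ if there is $f\in L^2(X,\mu)$, $f\ne0$, with $f\circ T=\lambda f$; it is a continuous eigenvalue if there is a continuous $f:X\to\mathbb C$, $f\neq0$, with $f\circ T=\lambda f$. A non continuous eigenvalue for $\mu$ is an eigenvalue for $\mu$ that is not a continuous eigenvalue. *)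

(* Defs.v *)
From HB Require Import structures.
From mathcomp Require Export all_boot all_order all_algebra.
From mathcomp Require Export finmap.
From mathcomp Require Export all_classical all_reals all_analysis.
From mathcomp.real_closed Require Export complex.

Set Implicit Arguments.
Unset Strict Implicit.
Unset Printing Implicit Defensive.

Export Order.TTheory GRing.Theory Num.Theory.
Export numFieldNormedType.Exports.

Local Open Scope classical_set_scope.
Local Open Scope ring_scope.

(* [edge n] is the set E_(n+1) of edges from V_n to V_(n+1). *)
Record bratteli := Bratteli {
  vertex : nat -> finType;
  edge : nat -> finType;
  src : forall n, edge n -> vertex n;
  tgt : forall n, edge n -> vertex n.+1;
  bratteli_root : #|vertex 0| = 1%N;
  tgt_surj : forall n (t : vertex n.+1), exists e : edge n, tgt e = t;
  src_surj : forall n (s : vertex n), exists e : edge n, src e = s }.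

Arguments src {b n} e.
Arguments tgt {b n} e.

(* Edges with the same end-point lie on the same level, so the partial order
   on the set of all edges is given level by level. *)
Record ordered_bratteli := OrderedBratteli {
  diagram :> bratteli;
  edge_le : forall n, rel (edge diagram n);
  edge_le_refl : forall n, reflexive (@edge_le n);
  edge_le_anti : forall n, antisymmetric (@edge_le n);
  edge_le_trans : forall n, transitive (@edge_le n);
  edge_comparable : forall n (e e' : edge diagram n),
    (edge_le e e' || edge_le e' e) = (tgt e == tgt e') }.

Arguments edge_le {o n} e e'.

Section Diagram.
Variable B : bratteli.

(* The entries of M_(n+1). *)
Definition incidence n (s : vertex B n) (t : vertex B n.+1) : nat :=
  #|[pred e : edge B n | (src e == s) && (tgt e == t)]|.

(* Paths from the root to t: a last edge, ending at t, together with a path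
   from the root to the initial vertex of that edge. *)
Fixpoint fpath n : vertex B n -> finType :=
  match n return vertex B n -> finType with
  | 0 => fun _ => unit
  | n'.+1 => fun t =>
      {e : {e : edge B n' | tgt e == t} & fpath (src (val e))} : finType
  end.

(* h_n(t) *)
Definition height n (t : vertex B n) : nat := #|fpath t|.

(* The number of edges of E_(n+1) ending at any given vertex of V_(n+1) is
   [q n]; so [q n] stands for q_(n+1). *)
Definition toeplitz_type (q : nat -> nat) : Prop :=
  forall n (t : vertex B n.+1), #|[pred e : edge B n | tgt e == t]| = q n.

Definition is_path (x : forall n, edge B n) : Prop :=
  forall n, tgt (x n) = src (x n.+1).

(* x_(n+1) of a path x = (x_1, x_2, ...) is [val x n]. *)
Definition path_space : Type := {x : forall n, edge B n | is_path x}.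

Definition cylinder (x : path_space) (n : nat) : set path_space :=
  [set y | forall k, (k < n)%N -> sval y k = sval x k].

Lemma path_space_inhabited : exists x : path_space, True.
Proof.
have nxt n (e : edge B n) : {e' : edge B n.+1 | src e' = tgt e}.
  exact: (cid (src_surj (tgt e))).
have [v _] : exists v, v \in vertex B 0.
  by apply/card_gt0P; rewrite bratteli_root.
have [e0 _] := src_surj v.
pose x := fix x n : edge B n :=
  match n with 0 => e0 | n'.+1 => sval (nxt n' (x n')) end.
have xP : is_path x by move=> n; exact: esym (svalP (nxt n (x n))).
by exists (exist _ x xP).
Qed.

HB.instance Definition _ := gen_eqMixin path_space.
HB.instance Definition _ := gen_choiceMixin path_space.
HB.instance Definition _ :=
  isPointed.Build path_space (sval (cid path_space_inhabited)).

Let cyl (i : path_space * nat) := cylinder i.1 i.2.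

Let cyl_cover : \bigcup_(i in setT) cyl i = setT.
Proof. by rewrite -subTset => x _; exists (x, 0%N). Qed.

Let cyl_join i j t : setT i -> setT j -> cyl i t -> cyl j t ->
  exists k, [/\ setT k, cyl k t & cyl k `<=` cyl i `&` cyl j].
Proof.
move=> _ _ it jt; exists (t, maxn i.2 j.2); split=> // y yt.
by split=> k kn; rewrite yt; [exact: it|rewrite leq_max kn|
  exact: jt|rewrite leq_max kn orbT].
Qed.

HB.instance Definition _ :=
  @isBaseTopological.Build path_space _ setT cyl cyl_cover cyl_join.

HB.instance Definition _ := Measurable.copy path_space
  (g_sigma_algebraType (@open path_space)).

End Diagram.

Section Vershik.
Variable B : ordered_bratteli.

Definition max_edge n (e : edge B n) : Prop :=
  forall e', edge_le e e' -> e' = e.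

Definition min_edge n (e : edge B n) : Prop :=
  forall e', edge_le e' e -> e' = e.

Definition succ_edge n (e e' : edge B n) : Prop :=
  [/\ edge_le e e', e != e' &
    forall f, edge_le e f -> edge_le f e' -> f = e \/ f = e'].

Definition max_path (x : path_space B) : Prop :=
  forall n, max_edge (sval x n).

Definition min_path (x : path_space B) : Prop :=
  forall n, min_edge (sval x n).

Definition properly_ordered : Prop :=
  (exists! x, max_path x) /\ (exists! x, min_path x).

(* For x other than x_max, n below is the least index of a non-maximal edge.
   On a properly ordered diagram exactly one map T satisfies this. *)
Definition vershik_map (T : path_space B -> path_space B) : Prop :=
  (forall x y, max_path x -> min_path y -> T x = y) /\
  (forall x n, (forall k, (k < n)%N -> max_edge (sval x k)) ->
     ~ max_edge (sval x n) ->
     [/\ forall k, (k < n)%N -> min_edge (sval (T x) k),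
         succ_edge (sval x n) (sval (T x) n) &
         forall k, (n < k)%N -> sval (T x) k = sval x k]).

Definition proper_of_rank (d : nat) : Prop :=
  [/\ properly_ordered,
      forall t : vertex B 1, height t = 1%N,
      forall n (s : vertex B n.+1) (t : vertex B n.+2),
        (0 < incidence s t)%N,
      forall n, #|vertex B n.+1| = d &
      forall n, exists s : vertex B n.+1,
        forall e : edge B n.+1, max_edge e -> src e = s].

End Vershik.

Section Dynamics.
Variable X : topologicalType.

Definition homeomorphism (T : X -> X) : Prop :=
  exists S : X -> X, [/\ cancel T S, cancel S T, continuous T & continuous S].

Definition minimal_map (T : X -> X) : Prop :=
  forall A : set X, closed A -> T @` A = A -> A = set0 \/ A = setT.

Definition minimal_cantor_system (T : X -> X) : Prop :=
  [/\ cantor_like X, homeomorphism T & minimal_map T].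

Definition continuous_eigenvalue (R : realType) (T : X -> X) (lam : R[i]) :
    Prop :=
  exists f : X -> R[i]^o,
    [/\ continuous f, exists x, f x != 0 & forall x, f (T x) = lam * f x].

End Dynamics.

Section Ergodic.
Variables (d : measure_display) (X : measurableType d) (R : realType).
Variable T : X -> X.

(* The library's measures are functions on all subsets of X, constrained on
   the measurable ones only.  Requiring the value 0 on the other subsets picks
   one function for each measure on the sigma-algebra, so that Leibniz
   equality and cardinality are those of measures. *)
Definition null_off_measurable (mu : probability X R) : Prop :=
  forall A, ~ measurable A -> mu A = 0%E.

Definition invariant_measure (mu : probability X R) : Prop :=
  forall A, measurable A -> mu (T @^-1` A) = mu A.

Definition ergodic_measure (mu : probability X R) : Prop :=
  forall A, measurable A -> T @^-1` A = A -> mu A = 0%E \/ mu A = 1%E.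

Definition ergodic_measures : set (probability X R) :=
  [set mu | [/\ null_off_measurable mu, invariant_measure mu &
               ergodic_measure mu]].

Definition square_integrable (mu : probability X R) (f : X -> R[i]) : Prop :=
  [/\ measurable_fun setT (fun x => complex.Re (f x)),
      measurable_fun setT (fun x => complex.Im (f x)) &
      (\int[mu]_x (complex.Re (f x) ^+ 2 + complex.Im (f x) ^+ 2)%:E < +oo)%E].

Definition eigenvalue_for (mu : probability X R) (lam : R[i]) : Prop :=
  exists f : X -> R[i],
    [/\ square_integrable mu f,
        ~ {ae mu, forall x, f x = 0} &
        {ae mu, forall x, f (T x) = lam * f x}].

End Ergodic.

Section Clean.
Variables (R : realType) (B : bratteli) (d : nat).
Variable T : path_space B -> path_space B.
(* the identification of V_(n+1) with {1, ..., d} *)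
Variable lab : forall n, 'I_d -> vertex B n.+1.

(* the event tau_(n+1) = t *)
Definition tau_event (n : nat) (t : 'I_d) : set (path_space B) :=
  [set x | tgt (sval x n) = lab n t].

(* The representation is clean, with I_mu = [I mu]. *)
Definition clean (I : probability (path_space B) R -> {set 'I_d}) : Prop :=
  (exists2 delta : R, 0 < delta &
    forall mu, ergodic_measures T mu ->
      (forall t n, t \in I mu -> (delta%:E <= mu (tau_event n t))%E) /\
      (forall t, t \notin I mu ->
         mu (tau_event n t) @[n --> \oo] --> 0%E)) /\
  (forall mu nu, ergodic_measures T mu -> ergodic_measures T nu ->
     mu <> nu -> forall t, ~~ ((t \in I mu) && (t \in I nu))).

End Clean.

Section Invariants.
Variables (R : realType) (B : bratteli).
Variables (T : path_space B -> path_space B) (q : nat -> nat).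

Definition pseq (n : nat) : nat := (\prod_(i < n) q i)%N.

Definition exp2ipi (b : nat) : R[i] :=
  Complex (cos (2 * pi / b%:R)) (sin (2 * pi / b%:R)).

Definition noncontinuous_eigenvalue (mu : probability (path_space B) R)
    (lam : R[i]) : Prop :=
  eigenvalue_for T mu lam /\ ~ continuous_eigenvalue T lam.

(* The set written B_mu *)
Definition Bset (mu : probability (path_space B) R) : set nat :=
  [set limn (fun m => (b %/ gcdn b (pseq m))%N) |
     b in [set b | (0 < b)%N /\ noncontinuous_eigenvalue mu (exp2ipi b)]].

Definition noncont_measures : set (probability (path_space B) R) :=
  [set mu | ergodic_measures T mu /\ Bset mu !=set0].

End Invariants.

Definition div_maximal (A : set nat) (c : nat) : Prop :=
  A c /\ forall c', A c' -> (c %| c')%N -> c' = c.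

(* The divisibility-maximal element of A, when there is exactly one. *)
Definition div_max (A : set nat) : nat := xget 0%N (div_maximal A).

(* Main.v *)
Require Import Defs.
From mathcomp Require Import measurable_realfun.
From mathcomp Require Import zify ring lra.

(** If exp(2i pi/b) is an eigenvalue for mu, then cutting an eigenfunction by a
    fundamental domain of the rotation of order b gives a set A of positive
    measure that is T^b-invariant and disjoint from T^-i A for 0 < i < b
    (a cyclic set); conversely such a set gives an eigenfunction.  Intersecting
    two cyclic sets of periods b1 and b2, one of them suitably translated, gives
    one of period lcm(b1, b2), so B_mu is directed for divisibility.

    For the bound b / gcd(b, p_n) <= #I_mu, the Toeplitz property makes all
    towers of level n have the same height p_n.  For n large, each T^-i A is
    almost a union of tower floors; moving the floors down to the base, each
    T^-v A almost fills or almost misses the base of each tower.  The measure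
    of T^-v A inside the union of the bases is invariant under v -> v + p_n,
    hence equally large for b / gcd(b, p_n) classes v modulo b.
    Towers outside I_mu being negligible, each of these classes fills more than
    half of the base of some tower in I_mu, and a base can be so filled only
    once.  The remaining assertions follow by counting, since the nonempty sets
    I_mu are pairwise disjoint. *)

Set Implicit Arguments.
Unset Strict Implicit.
Unset Printing Implicit Defensive.

Local Open Scope classical_set_scope.
Local Open Scope ring_scope.

(** * Position of a path in its tower *)

Section Rank.
Variables (B : ordered_bratteli) (q : nat -> nat).
Hypothesis Btoeplitz : toeplitz_type B q.

(** Only edges with the end-point of [e] are comparable to it, so this is the rank of [e], counted
    from 0, in the linear order on these edges. It serves as a digit. *)
Definition erank n (e : edge B n) : nat :=
  #|[pred e' | edge_le e' e && (e' != e)]|.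

Lemma edge_le_tgt n (e e' : edge B n) : edge_le e e' -> tgt e = tgt e'.
Proof. by move=> h; apply/eqP; rewrite -edge_comparable h. Qed.

Lemma erank_bound n (e : edge B n) : (erank e < q n)%N.
Proof.
rewrite -(Btoeplitz (tgt e)); apply/proper_card/properP; split.
  by apply/fintype.subsetP => f; rewrite !inE => /andP[/edge_le_tgt -> _].
by exists e; rewrite !inE ?eqxx ?andbF.
Qed.

Lemma erank_lt n (e e' : edge B n) :
  edge_le e e' -> e != e' -> (erank e < erank e')%N.
Proof.
move=> ee' ne; apply/proper_card/properP; split.
  apply/fintype.subsetP => f; rewrite !inE => /andP[fe nfe].
  rewrite (edge_le_trans fe ee') /=; apply: contra_neq nfe => fe'.
  by apply: (@edge_le_anti B n); rewrite fe fe' ee'.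
by exists e; rewrite !inE ?ee' ?eqxx ?andbF.
Qed.

Lemma erank_inj n (e e' : edge B n) :
  tgt e = tgt e' -> erank e = erank e' -> e = e'.
Proof.
move=> tee' ree'; apply/eqP; apply: contraT => ne.
have := edge_comparable e e'; rewrite tee' eqxx => /orP[] h.
  by have := erank_lt h ne; rewrite ree' ltnn.
by have := erank_lt h; rewrite eq_sym ree' ltnn => /(_ ne).
Qed.

Lemma erank_min n (e : edge B n) : min_edge e -> erank e = 0%N.
Proof.
move=> emin; apply: eq_card0 => f; rewrite !inE; apply/negP => /andP[/emin ->].
by rewrite eqxx.
Qed.

Lemma erank_max n (e : edge B n) : max_edge e -> (erank e).+1 = q n.
Proof.
move=> emax; rewrite -(Btoeplitz (tgt e)) (cardD1 e) !inE eqxx add1n.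
congr _.+1; apply: eq_card => f; rewrite !inE andbC; case: eqVneq => //= ne.
rewrite -edge_comparable; case: (boolP (edge_le e f)) => [/emax fe|_].
  by rewrite fe eqxx in ne.
by rewrite orbF.
Qed.

Lemma erank_succ n (e e' : edge B n) :
  succ_edge e e' -> erank e' = (erank e).+1.
Proof.
move=> [ee' ne suc]; rewrite /erank (cardD1 e) !inE ee' ne add1n.
congr _.+1; apply: eq_card => f; rewrite !inE.
case: (eqVneq f e) => [->|nfe]/=; first by rewrite andbF.
rewrite andbT; apply/andP/idP => [[fe' nfe']|fe].
  have := edge_comparable e f.
  rewrite (edge_le_tgt ee') (edge_le_tgt fe') eqxx => /orP[ef|//].
  by case: (suc f ef fe') => h; rewrite h eqxx in nfe nfe'.
split; first exact: edge_le_trans fe ee'.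
apply: contra_neq nfe => fe'.
by apply: (@edge_le_anti B n); rewrite fe fe' ee'.
Qed.

(* The height of x in its tower of level n.  All towers of level k having height
   p_k, the lexicographic order on paths, in which later edges weigh more, is
   a mixed-radix numeration. *)
Definition tower_pos n (x : path_space B) : nat :=
  (\sum_(k < n) erank (sval x k) * pseq q k)%N.

Lemma tower_posS n x :
  tower_pos n.+1 x = (tower_pos n x + erank (sval x n) * pseq q n)%N.
Proof. by rewrite /tower_pos big_ord_recr. Qed.

Lemma pseqS n : pseq q n.+1 = (pseq q n * q n)%N.
Proof. by rewrite /pseq big_ord_recr. Qed.

Lemma tower_pos_lt n x : (tower_pos n x < pseq q n)%N.
Proof.
elim: n => [|n IH]; first by rewrite /tower_pos /pseq !big_ord0.
rewrite tower_posS pseqS; have := erank_bound (sval x n); nia.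
Qed.

Lemma pseq_gt0 n : (0 < pseq q n)%N.
Proof. exact: leq_ltn_trans (tower_pos_lt n point). Qed.

Lemma tower_pos_max n x : (forall k, (k < n)%N -> max_edge (sval x k)) ->
  (tower_pos n x).+1 = pseq q n.
Proof.
elim: n => [|n IH] xmax; first by rewrite /tower_pos /pseq !big_ord0.
rewrite tower_posS pseqS -(erank_max (xmax n _)) // -IH; first lia.
by move=> k kn; apply: xmax; exact: leqW.
Qed.

Lemma tower_pos_min n x : (forall k, (k < n)%N -> min_edge (sval x k)) ->
  tower_pos n x = 0%N.
Proof.
move=> xmin; rewrite /tower_pos big1// => k _; rewrite erank_min//; exact: xmin.
Qed.

(** The digits are read from the top. The leading digit and the end-point determine the last edge;
    its initial vertex is the end-point of the edge before, and the induction goes down. *)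
Lemma tower_pos_tgt_inj n x y :
  tower_pos n.+1 x = tower_pos n.+1 y -> tgt (sval x n) = tgt (sval y n) ->
  forall k, (k <= n)%N -> sval x k = sval y k.
Proof.
elim: n => [|n IH] pxy txy k.
  rewrite leqn0 => /eqP ->; apply: erank_inj => //.
  move: pxy; rewrite !tower_posS /tower_pos !big_ord0 /pseq big_ord0.
  by rewrite !add0n !muln1.
have [lx ly] := (tower_pos_lt n.+1 x, tower_pos_lt n.+1 y).
have exy : erank (sval x n.+1) = erank (sval y n.+1).
  by move: pxy; rewrite 2!(tower_posS n.+1); nia.
have enxy := erank_inj txy exy.
rewrite leq_eqVlt => /predU1P[-> //|]; rewrite ltnS; apply: IH.
  by move: pxy; rewrite 2!(tower_posS n.+1) exy; lia.
by rewrite (svalP x) (svalP y) enxy.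
Qed.

Variable T : path_space B -> path_space B.
Hypothesis Bord : properly_ordered B.
Hypothesis Tvershik : vershik_map T.

(** [T] is an odometer, adding 1 with carry. If the first n edges are maximal, the position p_n - 1
    falls back to 0; otherwise the edge replaced by its successor is among the first n and keeps its
    end-point, so the vertex at level n is unchanged. For n > 0 this vertex ends the edge of index n
    - 1, hence the form [n = m.+1]. *)
Lemma vershik_step n x :
  [/\ (tower_pos n x).+1 = pseq q n & tower_pos n (T x) = 0%N] \/
  [/\ ((tower_pos n x).+1 < pseq q n)%N,
      tower_pos n (T x) = (tower_pos n x).+1 &
      forall m, n = m.+1 -> tgt (sval (T x) m) = tgt (sval x m)].
Proof.
have [Tmax Tstep] := Tvershik.
have [xmax|/existsNP[k0 nk0]] := pselect (max_path x).
  left; split; first exact: tower_pos_max.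
  case: Bord => _ [y [ymin _]].
  by rewrite (Tmax x y)//; apply: tower_pos_min => k _; exact: ymin.
have exk : exists k, `[< ~ max_edge (sval x k) >] by exists k0; exact/asboolP.
case: (ex_minnP exk) => k /asboolP nk kmin.
have kmax j : (j < k)%N -> max_edge (sval x j).
  by move=> jk; apply: contrapT => /asboolP/kmin; rewrite leqNgt jk.
have [Tmin Tsucc Trest] := Tstep x k kmax nk.
case: (leqP n k) => [nk'|kn].
  by left; split; [apply: tower_pos_max|apply: tower_pos_min] => j jn;
    [apply: kmax|apply: Tmin]; exact: leq_trans jn nk'.
right.
(* The digits below [k], worth p_k - 1 together, drop to 0, while digit [k] gains one unit, worth
   p_k; the higher digits do not move. *)
have posE : tower_pos n (T x) = (tower_pos n x).+1.
  elim: n kn => // n IH; rewrite ltnS leq_eqVlt => /predU1P[<-|kn].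
    rewrite !tower_posS (tower_pos_min Tmin) (erank_succ Tsucc).
    by rewrite -(tower_pos_max kmax); lia.
  by rewrite !tower_posS IH// Trest.
split => //; first by rewrite -posE tower_pos_lt.
move=> m nm; move: kn; rewrite nm ltnS leq_eqVlt => /predU1P[<-|km].
  by case: Tsucc => /edge_le_tgt.
by rewrite Trest.
Qed.

End Rank.

(** * Approximation of measurable sets by finite levels *)

Section RealMeasure.
Variables (d : measure_display) (X : measurableType d) (R : realType).
Variable mu : probability X R.

Definition rmeas (A : set X) : R := fine (mu A).

Lemma rmeasE A : measurable A -> mu A = (rmeas A)%:E.
Proof. by move=> mA; rewrite fineK// fin_num_measure. Qed.

Lemma rmeas_ge0 A : 0 <= rmeas A.
Proof. exact: fine_ge0. Qed.

Lemma rmeas0 : rmeas set0 = 0.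
Proof. by rewrite /rmeas measure0. Qed.

Lemma rmeasT : rmeas setT = 1.
Proof. by rewrite /rmeas probability_setT. Qed.

Lemma rmeasU A B : measurable A -> measurable B -> A `&` B = set0 ->
  rmeas (A `|` B) = rmeas A + rmeas B.
Proof.
move=> mA mB AB0; apply: EFin_inj; rewrite EFinD -!rmeasE//.
  exact: measureU.
exact: measurableU.
Qed.

Lemma rmeas_split A B : measurable A -> measurable B ->
  rmeas A = rmeas (A `&` B) + rmeas (A `\` B).
Proof.
move=> mA mB; rewrite -rmeasU; [by rewrite setUIDK|exact: measurableI| |].
  exact: measurableD.
by apply/seteqP; split=> // x [[_ ?] [_]].
Qed.

Lemma le_rmeas A B : measurable A -> measurable B -> A `<=` B ->
  rmeas A <= rmeas B.
Proof.
move=> mA mB AB; rewrite (rmeas_split mB mA) (_ : B `&` A = A).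
  by rewrite lerDl rmeas_ge0.
by apply/seteqP; split=> [x []//|x Ax]; split=> //; exact: AB.
Qed.

Lemma rmeasU_le A B : measurable A -> measurable B ->
  rmeas (A `|` B) <= rmeas A + rmeas B.
Proof.
move=> mA mB; rewrite (rmeas_split (measurableU _ _ mA mB) mA); apply: lerD.
  by apply: le_rmeas;
    [apply: measurableI => //; exact: measurableU| |move=> x []].
by apply: le_rmeas;
  [apply: measurableD => //; exact: measurableU| |move=> x [[]]].
Qed.

Lemma rmeas_big_setU (I : choiceType) (s : seq I) (F : I -> set X) :
  uniq s -> (forall i, measurable (F i)) ->
  (forall i j x, F i x -> F j x -> i = j) ->
  rmeas (\big[setU/set0]_(i <- s) F i) = \sum_(i <- s) rmeas (F i).
Proof.
move=> us mF dF; elim: s us => [|i s IH] /=; first by rewrite !big_nil rmeas0.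
move=> /andP[nis us]; rewrite !big_cons rmeasU ?IH//.
  by apply: bigsetU_measurable => j _.
apply/seteqP; split=> // x [Fi]; rewrite -bigcup_seq => -[j /= js Fj].
by move: nis; rewrite (dF _ _ _ Fi Fj) js.
Qed.

Lemma rmeas_partition (I : finType) (f : X -> I) (A : set X) :
  measurable A -> (forall i, measurable [set x | f x = i]) ->
  rmeas A = \sum_i rmeas (A `&` [set x | f x = i]).
Proof.
move=> mA mf; rewrite -rmeas_big_setU ?index_enum_uniq//.
- congr rmeas; apply/seteqP; split=> x.
    move=> Ax; rewrite -bigcup_seq; exists (f x) => //=.
    by rewrite mem_index_enum.
  by rewrite -bigcup_seq => -[i _ []].
- by move=> i; exact: measurableI.
- by move=> i j x [_ <-] [_ <-].
Qed.

Lemma rmeas_bigcup_approx (F : (set X)^nat) (e : R) :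
  (forall n, measurable (F n)) -> nondecreasing_seq F -> 0 < e ->
  exists n, rmeas (\bigcup_k F k `\` F n) < e.
Proof.
move=> mF ndF e0.
have mU : measurable (\bigcup_k F k) by exact: bigcup_measurable.
have cF : (fun n => mu (F n)) @ \oo --> mu (\bigcup_k F k).
  exact: nondecreasing_cvg_mu.
move: cF; rewrite (rmeasE mU) => /fine_cvgP[_] /cvgrPdist_lt /(_ e e0)[n _].
move=> /(_ n (leqnn n)) /=.
rewrite (rmeas_split mU (mF n)) (_ : _ `&` F n = F n).
  rewrite /rmeas/= addrAC subrr add0r => /(le_lt_trans (ler_norm _)) ?.
  by exists n.
by apply/seteqP; split=> [x []//|x ?]; split=> //; exists n.
Qed.

(** The measure of the symmetric difference, a pseudometric on measurable sets. *)
Definition sdist (A B : set X) : R := rmeas (A `\` B) + rmeas (B `\` A).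

Lemma sdist_refl A : sdist A A = 0.
Proof. by rewrite /sdist setDv rmeas0 addr0. Qed.

Lemma sdist_triangle A B C : measurable A -> measurable B -> measurable C ->
  sdist A C <= sdist A B + sdist B C.
Proof.
move=> mA mB mC; rewrite /sdist addrACA [X in _ <= _ + X]addrC; apply: lerD.
- apply: le_trans (rmeasU_le _ _); try exact: measurableD.
  apply: le_rmeas; [exact: measurableD|apply: measurableU; exact: measurableD|].
  by move=> x [Ax nC]; have [Bx|nB] := pselect (B x); [right|left].
- apply: le_trans (rmeasU_le _ _); try exact: measurableD.
  apply: le_rmeas; [exact: measurableD|apply: measurableU; exact: measurableD|].
  by move=> x [Cx nA]; have [Bx|nB] := pselect (B x); [right|left].
Qed.

Lemma sdistC A B : sdist (~` A) (~` B) = sdist A B.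
Proof. by rewrite /sdist !setDE !setCK addrC setIC [X in _ + rmeas X]setIC. Qed.

Lemma sdistU A B C D : measurable A -> measurable B -> measurable C ->
  measurable D -> sdist (A `|` B) (C `|` D) <= sdist A C + sdist B D.
Proof.
move=> mA mB mC mD; rewrite /sdist addrACA; apply: lerD.
- apply: le_trans (rmeasU_le _ _); try exact: measurableD.
  apply: le_rmeas; [apply: measurableD; exact: measurableU|
    apply: measurableU; exact: measurableD|].
  by move=> x [[Ax|Bx] /not_orP[nC nD]]; [left|right].
- apply: le_trans (rmeasU_le _ _); try exact: measurableD.
  apply: le_rmeas; [apply: measurableD; exact: measurableU|
    apply: measurableU; exact: measurableD|].
  by move=> x [[Ax|Bx] /not_orP[nC nD]]; [left|right].
Qed.

End RealMeasure.

Section Approximation.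
Variables (B : bratteli) (R : realType) (mu : probability (path_space B) R).

(** Unions of cylinders of length n: events decided by the first n edges. *)
Definition level_set n (U : set (path_space B)) : Prop :=
  forall x, U x -> cylinder x n `<=` U.

Lemma level_setW m n U : (m <= n)%N -> level_set m U -> level_set n U.
Proof.
move=> mn lU x Ux y xy; apply: lU Ux _ _ => k km; apply: xy.
exact: leq_trans km mn.
Qed.

Lemma cylinder_open (x : path_space B) n : open (cylinder x n).
Proof.
exists [set (x, n)] => //; apply/seteqP; split=> y.
  by case=> i /= ->.
by move=> ?; exists (x, n).
Qed.

Lemma level_set_open n U : level_set n U -> open U.
Proof.
move=> lU; rewrite (_ : U = \bigcup_(x in U) cylinder x n).
  by apply: bigcup_open => x _; exact: cylinder_open.
by apply/seteqP; split=> [x Ux|y [x Ux xy]]; [exists x|exact: lU xy].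
Qed.

Lemma open_measurable_path (U : set (path_space B)) : open U -> measurable U.
Proof. exact: sub_sigma_algebra. Qed.

Lemma level_set_measurable n U : level_set n U -> measurable U.
Proof. by move=> /level_set_open/open_measurable_path. Qed.

Lemma level_setC n U : level_set n U -> level_set n (~` U).
Proof.
move=> lU x nUx y xy Uy; apply: nUx; apply: lU Uy _ _ => k kn.
by rewrite xy.
Qed.

Lemma level_setU n U V : level_set n U -> level_set n V ->
  level_set n (U `|` V).
Proof.
by move=> lU lV x [Ux|Vx] y xy; [left; exact: lU xy|right; exact: lV xy].
Qed.

Definition approximable (A : set (path_space B)) : Prop :=
  forall e : R, 0 < e ->
    exists n U, level_set n U /\ sdist mu A U < e.

Lemma approximableC A : approximable A -> approximable (~` A).
Proof.
move=> aA e /aA[n [U [lU AU]]]; exists n, (~` U).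
by rewrite sdistC; split=> //; exact: level_setC.
Qed.

Lemma approximableU A A' : measurable A -> measurable A' ->
  approximable A -> approximable A' -> approximable (A `|` A').
Proof.
move=> mA mA' aA aA' e e0.
have e20 : 0 < e / 2 by rewrite divr_gt0.
have [n [U [lU AU]]] := aA _ e20; have [n' [U' [lU' AU']]] := aA' _ e20.
exists (maxn n n'), (U `|` U'); split.
  by apply: level_setU; [apply: level_setW lU|apply: level_setW lU'];
    rewrite leq_max leqnn ?orbT.
rewrite (splitr e); apply: le_lt_trans (ltrD AU AU').
by apply: sdistU => //; [exact: level_set_measurable lU|
  exact: level_set_measurable lU'].
Qed.

Lemma approximable_level n U : level_set n U -> approximable U.
Proof. by move=> lU e e0; exists n, U; rewrite sdist_refl. Qed.

(** By continuity from below, some [F n] misses less than e/2 of the union, and a level set lies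
    within e/2 of that [F n]. *)
Lemma approximable_nondecreasing_bigcup (F : (set (path_space B))^nat) :
  (forall n, measurable (F n)) -> nondecreasing_seq F ->
  (forall n, approximable (F n)) -> approximable (\bigcup_n F n).
Proof.
move=> mF ndF aF e e0; have e20 : 0 < e / 2 by rewrite divr_gt0.
have [n Fn] := rmeas_bigcup_approx mu mF ndF e20.
have [m [U [lU FU]]] := aF n _ e20; exists m, U; split=> //.
have mU := level_set_measurable lU.
rewrite (splitr e); apply: le_lt_trans (ltrD Fn FU).
apply: le_trans (sdist_triangle mu _ (mF n) mU) _.
  exact: bigcup_measurable.
rewrite lerD2r /sdist (_ : F n `\` _ = set0) ?rmeas0 ?addr0//.
by apply/seteqP; split=> // x [Fx]; apply; exists n.
Qed.

Lemma approximable_bigcup (F : (set (path_space B))^nat) :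
  (forall n, measurable (F n)) ->
  (forall n, approximable (F n)) -> approximable (\bigcup_n F n).
Proof.
move=> mF aF; rewrite -bigcup_bigsetU_bigcup.
have mG n : measurable (\big[setU/set0]_(i < n) F i).
  by apply: bigsetU_measurable.
apply: approximable_nondecreasing_bigcup => [n|m n mn|n]; first exact: mG.
  exact/subsetPset/subset_bigsetU.
elim: n.+1 => {n} [|n IH].
  by rewrite big_ord0; apply: (approximable_level (n := 0%N)) => x.
by rewrite big_ord_recr; exact: approximableU (mG n) (mF n) IH (aF n).
Qed.

(** An open set is the increasing union over n of the level sets formed by its points whose cylinder
    of length n it contains. *)
Lemma open_approximable U : open U -> approximable U.
Proof.
move=> oU; pose F n := [set x | cylinder x n `<=` U].
have lF n : level_set n (F n).
  move=> x Fx y xy z yz; apply: Fx => k kn.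
  by rewrite yz// xy.
have -> : U = \bigcup_n F n.
  apply/seteqP; split=> [x Ux|x [n _]]; last by apply.
  have [D _ DU] : exists2 D : set (path_space B * nat), D `<=` setT &
    \bigcup_(i in D) cylinder i.1 i.2 = U := oU.
  move: (Ux); rewrite -{1}DU; move=> [[y n] Dyn xyn].
  exists n => // z xz; rewrite -DU; exists (y, n) => // k kn.
  by rewrite xz// xyn.
apply: approximable_nondecreasing_bigcup => [n|m n mn|n].
- exact: level_set_measurable (lF n).
- apply/subsetPset => x Fx z xz; apply: Fx => k km; apply: xz.
  exact: leq_trans km mn.
- exact: approximable_level (lF n).
Qed.

(** The measurable approximable sets form a sigma-algebra containing the open sets, which
    generate. *)
Lemma measurable_approximable A : measurable A -> approximable A.
Proof.
pose C := [set A | measurable A /\ approximable A].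
suff : measurable `<=` C by move=> h /h[].
apply: smallest_sub.
  split.
  - by split=> //; apply: (approximable_level (n := 0%N)) => x.
  - move=> A0 [mA aA]; rewrite setTD; split; first exact: measurableC.
    exact: approximableC.
  - move=> F CF; split; first by apply: bigcup_measurable => n _; case: (CF n).
    by apply: approximable_bigcup => n; case: (CF n).
move=> U oU; split; first exact: open_measurable_path.
exact: open_approximable.
Qed.

End Approximation.

(** * Eigenvalues and cyclic sets *)

Section RootOfUnity.
Variable R : realType.

Lemma exp2ipiX b k : exp2ipi R b ^+ k =
  Complex (cos (k%:R * (2 * pi / b%:R))) (sin (k%:R * (2 * pi / b%:R))).
Proof.
rewrite /exp2ipi; set t : R := _ / _.
elim: k => [|k IH]; first by rewrite expr0 mul0r cos0 sin0.
rewrite exprS IH -(natr1 k) mulrDl mul1r cosD sinD.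
by apply/eqP; rewrite eq_complex /=; apply/andP; split; apply/eqP; ring.
Qed.

Lemma exp2ipi_order b : (0 < b)%N -> exp2ipi R b ^+ b = 1.
Proof.
move=> b0; rewrite exp2ipiX mulrC divfK ?pnatr_eq0 -?lt0n//.
by rewrite mulr_natl cos2pi sin2pi.
Qed.

(** Let r be the remainder of k modulo b and t = pi r / b. If 0 < r then t lies strictly between 0
    and pi, so sin t > 0, which contradicts cos 2t = 1. *)
Lemma exp2ipi_eq1 b k : (0 < b)%N -> exp2ipi R b ^+ k = 1 -> (b %| k)%N.
Proof.
move=> b0; rewrite -(expr_mod k (exp2ipi_order b0)) => h.
apply: contraT; rewrite /dvdn -lt0n => r0.
have rb : (k %% b < b)%N by rewrite ltn_mod.
move: (k %% b)%N h r0 rb => r; rewrite exp2ipiX => -[hc _] r0 rb.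
have br : 0 < b%:R :> R by rewrite ltr0n.
pose t : R := pi * (r%:R / b%:R).
have : 0 < sin t.
  apply: sin_gt0_pi; rewrite mulr_gt0 ?pi_gt0 ?divr_gt0 ?ltr0n//=.
  by rewrite gtr_pMr ?pi_gt0// ltr_pdivrMr// mul1r ltr_nat.
move: hc; rewrite (_ : _ * _ = t *+ 2); last first.
  by rewrite /t -mulr_natl; ring.
rewrite cos_mulr2n; have := cos2Dsin2 t; nra.
Qed.

Lemma exp2ipi_dvd b c : (0 < b)%N -> (c %| b)%N ->
  exp2ipi R b ^+ (b %/ c) = exp2ipi R c.
Proof.
move=> b0 cb; have c0 := dvdn_gt0 b0 cb.
rewrite exp2ipiX (_ : _ * _ = 2 * pi / c%:R)//.
have c0' : c%:R != 0 :> R by rewrite pnatr_eq0 -lt0n.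
have k0 : (b %/ c)%:R != 0 :> R.
  by rewrite pnatr_eq0 -lt0n divn_gt0// dvdn_leq.
by rewrite -[in X in _ / X](divnK cb) natrM; field; rewrite k0 c0'.
Qed.

(** A strict total order whose comparisons are measurable; it picks one point from each orbit of a
    rotation. *)
Definition lexlt (z w : R[i]) : bool :=
  (complex.Re z < complex.Re w) ||
  ((complex.Re z == complex.Re w) && (complex.Im z < complex.Im w)).

Lemma lexlt_asym z w : lexlt z w -> lexlt w z -> False.
Proof.
rewrite /lexlt => /orP[zw|/andP[/eqP -> zw]] /orP[wz|/andP[/eqP wz wz']]; lra.
Qed.

Lemma lexlt_total z w : z != w -> lexlt z w \/ lexlt w z.
Proof.
rewrite eq_complex /lexlt.
by case: (ltgtP (complex.Re z) (complex.Re w)) => //= _;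
  [left|right|case: ltgtP; auto].
Qed.

Lemma lexlt_trans : transitive lexlt.
Proof.
move=> y x z; rewrite /lexlt.
move=> /orP[xy|/andP[/eqP -> xy]] /orP[yz|/andP[/eqP yE yz]].
- by rewrite (lt_trans xy yz).
- by rewrite -yE xy.
- by rewrite yz.
- by rewrite yE eqxx (lt_trans xy yz) orbT.
Qed.

Lemma lexlt_max (g : nat -> R[i]) n : (0 < n)%N ->
  exists2 j, (j < n)%N & forall i, (i < n)%N -> g i != g j -> lexlt (g i) (g j).
Proof.
elim: n => // -[|n] IH _; first by exists 0%N => // -[|//] _; rewrite eqxx.
have [j jn jmax] := IH isT.
have [E|ne] := eqVneq (g n.+1) (g j).
  exists j; first exact: leqW.
  move=> i; rewrite ltnS leq_eqVlt => /predU1P[->|]; last exact: jmax.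
  by rewrite E eqxx.
have [nj|jn'] := lexlt_total ne.
  exists j; first exact: leqW.
  by move=> i; rewrite ltnS leq_eqVlt => /predU1P[->//|]; exact: jmax.
exists n.+1 => // i; rewrite ltnS leq_eqVlt => /predU1P[->|]; first by rewrite eqxx.
move=> i_n _; have [->//|ij] := eqVneq (g i) (g j).
exact: lexlt_trans (jmax _ i_n ij) jn'.
Qed.

End RootOfUnity.

Section Cyclic.
Variables (d : measure_display) (X : measurableType d) (R : realType).
Variables (mu : probability X R) (T : X -> X).
Hypothesis mT : measurable_fun setT T.
Hypothesis Tinv : invariant_measure T mu.

Lemma measurable_preimageT A : measurable A -> measurable (T @^-1` A).
Proof. by move=> mA; rewrite -[X in measurable X]setTI; exact: mT. Qed.

Lemma measurable_iter i A : measurable A -> measurable [set x | A (iter i T x)].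
Proof.
move=> mA; elim: i => [|i IH]//=.
rewrite (_ : [set x | _] = T @^-1` [set x | A (iter i T x)]).
  exact: measurable_preimageT.
by apply/seteqP; split=> x /=; rewrite -iterSr.
Qed.

Lemma rmeas_preimageT A : measurable A -> rmeas mu (T @^-1` A) = rmeas mu A.
Proof. by move=> mA; rewrite /rmeas Tinv. Qed.

(* Period b of A is exact and holds at every point, not only almost everywhere:
   null sets never have to be carried through iterates of T. *)
Definition cyclic_set (b : nat) (A : set X) : Prop :=
  [/\ measurable A, 0 < rmeas mu A,
      forall x, A (iter b T x) <-> A x &
      forall i x, A x -> A (iter i T x) -> (b %| i)%N].

Lemma cyclic_iterM b A k x : cyclic_set b A -> A (iter (k * b) T x) <-> A x.
Proof.
move=> [_ _ cA _]; elim: k => // k IH.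
by rewrite mulSn iterD; split=> [/cA/IH|/IH/cA].
Qed.

Lemma rmeas_bigcup_le (F : nat -> set X) n : (forall i, measurable (F i)) ->
  rmeas mu (\big[setU/set0]_(i < n) F i) <= \sum_(i < n) rmeas mu (F i).
Proof.
move=> mF; elim: n => [|n IH]; first by rewrite !big_ord0 rmeas0.
rewrite !big_ord_recr/=; apply: le_trans (rmeasU_le _ _ _) _ => //.
  by apply: bigsetU_measurable => i _.
by rewrite lerD2r.
Qed.

(** The union [U] of the sets T^-j A2 for j < b2 is invariant, hence of full measure by ergodicity.
    So some T^-j A2 meets A1 in positive measure, and return times to this intersection are
    multiples of both periods. *)
Lemma cyclic_lcm b1 b2 A1 A2 : ergodic_measure T mu -> (0 < b2)%N ->
  cyclic_set b1 A1 -> cyclic_set b2 A2 -> exists A, cyclic_set (lcmn b1 b2) A.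
Proof.
move=> Terg b20 cy1 cy2.
have [mA1 A1_gt0 A1b A1i] := cy1; have [mA2 A2_gt0 A2b A2i] := cy2.
pose F j := [set x | A2 (iter j T x)].
have mF j : measurable (F j) by exact: measurable_iter.
pose U := \big[setU/set0]_(j < b2) F j.
have mU : measurable U by apply: bigsetU_measurable => j _.
have UE : U = [set x | exists2 j, (j < b2)%N & A2 (iter j T x)].
  by rewrite /U -bigcup_mkord; apply/seteqP; split=> x [j /= ? ?]; exists j.
(* Preimage by [T] shifts j by one; the index wraps around at [b2] because A2 is T^b2-invariant. *)
have UT : T @^-1` U = U.
  rewrite UE; apply/seteqP; split=> x [j jb Aj].
    rewrite -iterSr in Aj; move: jb; rewrite leq_eqVlt.
    move=> /predU1P[jb|]; last by exists j.+1.
    by exists 0%N => //; apply/A2b; rewrite -jb.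
  case: j jb Aj => [|j] jb; last by rewrite iterSr => ?; exists j => //; exact: ltnW.
  by move=> /A2b A2x; exists b2.-1; rewrite /= -?iterSr prednK.
have U1 : rmeas mu (~` U) = 0.
  have : 0 < rmeas mu U.
    apply: lt_le_trans A2_gt0 _; apply: le_rmeas => // x A2x.
    by rewrite UE; exists 0%N.
  rewrite /rmeas; case: (Terg U mU UT) => [->|U1]; first by rewrite ltxx.
  by rewrite probability_setC// U1 subee.
(* Otherwise A1 would be covered by the null sets [A1]&[F i] and the null complement of [U]. *)
have [j jP] : exists j, 0 < rmeas mu (A1 `&` F j).
  apply: contrapT => /forallNP h.
  have : rmeas mu A1 <= 0.
    rewrite (rmeas_split mu mA1 mU); rewrite -[leRHS]addr0; apply: lerD.
      have mAF i : measurable (A1 `&` F i) by exact: measurableI.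
      rewrite /U big_distrr/=; apply: le_trans (rmeas_bigcup_le b2 mAF) _.
      by apply: sumr_le0 => i _; rewrite leNgt; apply/negP; exact: h.
    rewrite -U1; apply: le_rmeas; [exact: measurableD|exact: measurableC|].
    by move=> x [].
  by rewrite leNgt A1_gt0.
exists (A1 `&` F j); split=> //.
- exact: measurableI.
- have [k1 k1E] := dvdnP (dvdn_lcml b1 b2).
  have [k2 k2E] := dvdnP (dvdn_lcmr b1 b2).
  move=> x; rewrite /F/= -iterD addnC iterD.
  split=> -[h1 h2]; split.
  + by move: h1; rewrite k1E => /(cyclic_iterM _ _ cy1).
  + by move: h2; rewrite k2E => /(cyclic_iterM _ _ cy2).
  + by rewrite k1E; apply/(cyclic_iterM _ _ cy1).
  + by rewrite k2E; apply/(cyclic_iterM _ _ cy2).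
- move=> i x [A1x A2x] [A1ix]; rewrite /F/= -iterD addnC iterD => A2ix.
  by rewrite dvdn_lcm (A1i _ _ A1x A1ix) (A2i _ _ A2x A2ix).
Qed.

End Cyclic.

Section EigenCyclic.
Variables (d : measure_display) (X : measurableType d) (R : realType).
Variables (mu : probability X R) (T : X -> X).
Hypothesis mT : measurable_fun setT T.
Hypothesis Tinv : invariant_measure T mu.

Lemma Re_sum (I : Type) (s : seq I) (F : I -> R[i]) :
  complex.Re (\sum_(i <- s) F i) = \sum_(i <- s) complex.Re (F i).
Proof. by apply: (big_morph (@complex.Re R)) => // -[? ?] []. Qed.

Lemma Im_sum (I : Type) (s : seq I) (F : I -> R[i]) :
  complex.Im (\sum_(i <- s) F i) = \sum_(i <- s) complex.Im (F i).
Proof. by apply: (big_morph (@complex.Im R)) => // -[? ?] []. Qed.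

Lemma bounded_square_integrable (f : X -> R[i]) (M : R) :
  measurable_fun setT (fun x => complex.Re (f x)) ->
  measurable_fun setT (fun x => complex.Im (f x)) ->
  (forall x, `|complex.Re (f x)| <= M) ->
  (forall x, `|complex.Im (f x)| <= M) -> square_integrable mu f.
Proof.
move=> mRe mIm bRe bIm; split=> //.
apply: (@le_lt_trans _ _ (\int[mu]_(x in setT) (cst (M ^+ 2 + M ^+ 2)%:E) x)%E).
  apply: ge0_le_integral => //=.
  - by move=> x _; rewrite lee_fin addr_ge0 ?sqr_ge0.
  - by apply/measurable_EFinP; apply: measurable_funD; exact: measurable_funX.
  - have sqM (a : R) : `|a| <= M -> a ^+ 2 <= M ^+ 2.
      move=> aM; rewrite -(real_normK (num_real a)) lerXn2r ?nnegrE//.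
      exact: le_trans aM.
    by move=> x _; rewrite lee_fin lerD// sqM.
rewrite integral_cst// [X in (_ * X)%E](_ : _ = 1%E) ?mule1 ?ltry//.
exact: probability_setT.
Qed.

(** The sets T^-i A for i < b are disjoint; the eigenfunction takes the value [lam ^- i] on T^-i A
    and 0 elsewhere. *)
Lemma cyclic_eigenvalue b A : (0 < b)%N -> cyclic_set mu T b A ->
  eigenvalue_for T mu (exp2ipi R b).
Proof.
move=> b0 [mA A_gt0 Ab Ai].
set lam := exp2ipi R b; have lamb : lam ^+ b = 1 := exp2ipi_order R b0.
have lam0 : lam != 0.
  by apply/eqP => l0; move/eqP: lamb; rewrite l0 expr0n gtn_eqF// eq_sym oner_eq0.
pose F i := [set x | A (iter i T x)].
have mF i : measurable (F i) by exact: measurable_iter.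
pose f x := \sum_(i < b) lam ^- i * Complex (\1_(F i) x) 0.
have ReE x : complex.Re (f x) = \sum_(i < b) complex.Re (lam ^- i) * \1_(F i) x.
  by rewrite Re_sum; apply: eq_bigr => i _; case: (lam ^- i) => a c /=; ring.
have ImE x : complex.Im (f x) = \sum_(i < b) complex.Im (lam ^- i) * \1_(F i) x.
  by rewrite Im_sum; apply: eq_bigr => i _; case: (lam ^- i) => a c /=; ring.
have mind (c : nat -> R) :
    measurable_fun setT (fun x => \sum_(i < b) c i * (\1_(F i) x : R)).
  by apply: measurable_sum => i; apply: measurable_funM => //; exact: measurable_indic.
have bind (c : nat -> R) x :
    `|\sum_(i < b) c i * (\1_(F i) x : R)| <= \sum_(i < b) `|c i|.
  apply: le_trans (ler_norm_sum _ _ _) _; apply: ler_sum => i _.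
  by rewrite normrM indicE; case: (x \in F i); rewrite ?normr1 ?mulr1// normr0 mulr0.
have F_shift i x : \1_(F i) (T x) = \1_(F i.+1) x :> R.
  rewrite !indicE (_ : (T x \in F i) = (x \in F i.+1))//.
  by apply/idP/idP => /set_mem h; apply/mem_set; move: h; rewrite /F/mkset iterSr.
have F_period x : \1_(F b) x = \1_(F 0%N) x :> R.
  rewrite !indicE (_ : (x \in F b) = (x \in F 0%N))//.
  by apply/idP/idP => /set_mem h; apply/mem_set; apply/Ab.
exists f; split.
- apply: (@bounded_square_integrable f
    (\sum_(i < b) `|complex.Re (lam ^- i)| +
     \sum_(i < b) `|complex.Im (lam ^- i)|)).
  + by rewrite (funext ReE); exact: (mind (fun i => complex.Re (lam ^- i))).
  + by rewrite (funext ImE); exact: (mind (fun i => complex.Im (lam ^- i))).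
  + move=> x; rewrite ReE.
    by rewrite (le_trans (bind (fun i => complex.Re (lam ^- i)) x))// lerDl sumr_ge0.
  + move=> x; rewrite ImE.
    by rewrite (le_trans (bind (fun i => complex.Im (lam ^- i)) x))// lerDr sumr_ge0.
(* On [A] only the term of index 0 survives, so [f] is 1 there, and vanishing almost everywhere
   would make [A] null. *)
- move=> f0; have : rmeas mu A = 0.
    rewrite /rmeas (measure_negligible mA)//; apply: negligibleS f0 => x Ax /= fx0.
    suff : f x = 1 by rewrite fx0 => /eqP; rewrite eq_sym oner_eq0.
    rewrite /f (bigD1 (Ordinal b0))//= big1 ?addr0.
      by rewrite expr0 invr1 mul1r indicE mem_set.
    move=> i; rewrite -val_eqE/= -lt0n => i0.
    rewrite indicE memNset ?mulr0// => /(Ai _ _ Ax) /(dvdn_leq i0).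
    by rewrite leqNgt ltn_ord.
  by move=> A0; rewrite A0 ltxx in A_gt0.
- apply: aeW => x; rewrite /f mulr_sumr.
  (* Composition with [T] shifts the index by one. The new last term [g b] equals the lost term
     [g 0], since [lam ^+ b = 1] and T^-b A = A. *)
  pose g i := lam * (lam ^- i * Complex (\1_(F i) x) 0).
  transitivity (\sum_(i < b) g i.+1).
    apply: eq_bigr => i _; rewrite /g mulrA exprS invfM mulVKf//.
    by rewrite F_shift.
  rewrite -(big_mkord xpredT g) -(big_mkord xpredT (fun i => g i.+1)).
  rewrite -(big_add1 _ _ 0%N b.+1 xpredT g)/= big_nat_recr//= addrC.
  rewrite [RHS]big_ltn//; congr (_ + _).
  rewrite /g lamb expr0; congr (_ * (_ * Complex _ _)).
  exact: F_period.
Qed.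

Variable S : X -> X.
Hypothesis mS : measurable_fun setT S.
Hypothesis TK : cancel T S.

Lemma invariant_inverse : invariant_measure S mu.
Proof.
move=> A mA; rewrite -Tinv; last first.
  by rewrite -[X in measurable X]setTI; exact: mS.
by congr (mu _); apply/seteqP; split=> x /=; rewrite TK.
Qed.

Lemma negligible_preimage_iter (U : X -> X) (N : set X) i :
  measurable_fun setT U -> invariant_measure U mu ->
  measurable N -> mu N = 0%E -> mu.-negligible [set x | N (iter i U x)].
Proof.
move=> mU Uinv mN N0; apply/negligibleP; first exact: measurable_iter.
elim: i => [//|i IH]; apply: etrans IH.
rewrite (_ : [set x | _] = U @^-1` [set x | N (iter i U x)]).
  by apply: Uinv; exact: measurable_iter.
by apply/seteqP; split=> x /=; rewrite -iterSr.
Qed.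

(* G is the complement of the two-sided orbit of the exceptional null set. *)
Lemma ae_eigen_strict (f : X -> R[i]) lam :
  {ae mu, forall x, f (T x) = lam * f x} ->
  exists G, [/\ measurable G, mu.-negligible (~` G),
    forall x, G (T x) <-> G x & forall x, G x -> f (T x) = lam * f x].
Proof.
move=> [N [mN N0 fN]].
pose H := \bigcup_n ([set x | N (iter n T x)] `|` [set x | N (iter n S x)]).
have mH : measurable H.
  by apply: bigcup_measurable => n _; apply: measurableU; exact: measurable_iter.
exists (~` H); split.
- exact: measurableC.
- rewrite setCK; apply: negligible_bigcup => n; apply: negligibleU.
    exact: negligible_preimage_iter.
  by apply: negligible_preimage_iter => //; exact: invariant_inverse.
- move=> x; split=> nH [n _ [Nx|Nx]]; apply: nH.
  + case: n Nx => [|n] Nx; first by exists 1%N => //; right; rewrite /= TK.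
    by exists n => //; left; rewrite /= -iterSr.
  + by exists n.+1 => //; right; rewrite /= -iterS iterSr TK.
  + by exists n.+1 => //; left; rewrite /= -iterS iterSr.
  + case: n Nx => [|n] Nx; first by exists 1%N => //; left.
    by exists n => //; right; move: Nx; rewrite /= -iterS iterSr TK.
- by move=> x nH; apply: contrapT => nf; apply: nH; exists 0%N => //; left; exact: fN.
Qed.

Lemma eigenvalue_cyclic b : (0 < b)%N -> eigenvalue_for T mu (exp2ipi R b) ->
  exists A, cyclic_set mu T b A.
Proof.
move=> b0; set lam := exp2ipi R b => -[f [[mRe mIm _] fn0 /ae_eigen_strict]].
have lamb : lam ^+ b = 1 := exp2ipi_order R b0.
move=> [G [mG G1 GT fT]].
(* Each orbit of z |-> lam * z off 0 meets S0 exactly once, at its lexicographic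
   maximum. *)
pose S0 : set R[i] :=
  [set z | forall i, (0 < i < b)%N -> lexlt (lam ^+ i * z) z].
(* This is a countable intersection of order comparisons, vacuous for i outside 0 < i < b, between
   real and imaginary parts that are real combinations of those of [f]. *)
have mS0 j : measurable [set x | S0 (lam ^+ j * f x)].
  pose P i := [set x | (0 < i < b)%N ==>
    lexlt (lam ^+ i * (lam ^+ j * f x)) (lam ^+ j * f x)].
  rewrite (_ : [set x | _] = \bigcap_i P i); last first.
    apply/seteqP; split=> x h i; first by move=> _; apply/implyP; exact: h.
    by have /implyP := h i I; exact.
  apply: bigcapT_measurable => i; rewrite /P.
  case: (_ < _ < _)%N; last first.
    by rewrite (_ : [set x | _] = setT)//; apply/seteqP; split.
  have mlin (k : R[i]) :
      measurable_fun setT (fun x => complex.Re (k * f x)) /\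
      measurable_fun setT (fun x => complex.Im (k * f x)).
    case: k => a c; split.
      rewrite (_ : (fun x => _) =
        (fun x => a * complex.Re (f x) - c * complex.Im (f x))).
        by apply: measurable_funB; apply: measurable_funM.
      by apply/funext => x; case: (f x).
    rewrite (_ : (fun x => _) =
      (fun x => a * complex.Im (f x) + c * complex.Re (f x))).
      by apply: measurable_funD; apply: measurable_funM.
    by apply/funext => x; case: (f x) => u v /=; ring.
  have [mR1 mI1] := mlin (lam ^+ j); have [mR2 mI2] := mlin (lam ^+ i * lam ^+ j).
  rewrite [X in measurable X](_ : _ = [set x | true =
     lexlt (lam ^+ i * lam ^+ j * f x) (lam ^+ j * f x)]); last first.
    by apply/seteqP; split=> x /=; rewrite mulrA.
  have mb : measurable_fun setT (fun x =>
      lexlt (lam ^+ i * lam ^+ j * f x) (lam ^+ j * f x)).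
    apply: measurable_or; first exact: measurable_fun_ltr.
    by apply: measurable_and; [exact: measurable_fun_eqr|exact: measurable_fun_ltr].
  have := mb measurableT [set true] I; rewrite setTI.
  by congr measurable; apply/seteqP; split=> x /=.
pose A j := G `&` [set x | S0 (lam ^+ j * f x)].
have mA j : measurable (A j) by exact: measurableI.
(* Wherever [f] is nonzero on [G], some [lam ^+ j * f x] is the maximum of its orbit. If all [A j]
   were null, [f] would vanish almost everywhere. *)
have [j jA] : exists j, 0 < rmeas mu (A j).
  apply: contrapT => /forallNP h; apply: fn0.
  have nA : mu.-negligible (\bigcup_j A j).
    apply: negligible_bigcup => j; apply/negligibleP => //.
    apply: etrans (rmeasE mu (mA j)) _; congr EFin; apply/eqP.
    rewrite eq_le rmeas_ge0 andbT leNgt.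
    exact/negP.
  apply: negligibleS (negligibleU G1 nA) => x /= /eqP fx0.
  have [Gx|] := pselect (G x); [right|by left].
  have [j jb jmax] := lexlt_max (fun i => lam ^+ i * f x) b0.
  exists j => //; split=> // i /andP[i0 ib].
  have -> : lam ^+ i * (lam ^+ j * f x) = lam ^+ ((i + j) %% b) * f x.
    by rewrite mulrA -exprD expr_mod.
  apply: jmax; first by rewrite ltn_mod.
  rewrite -subr_eq0 -mulrBl mulf_neq0// subr_eq0.
  apply/eqP => E; have : lam ^+ i = 1.
    have lj0 : lam ^+ j != 0.
      rewrite expf_neq0//; apply/eqP => l0; move/eqP: lamb.
      by rewrite l0 expr0n gtn_eqF// eq_sym oner_eq0.
    by apply: (mulIf lj0); rewrite mul1r -[RHS]E expr_mod// exprD.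
  by move=> /(exp2ipi_eq1 b0)/(dvdn_leq i0); rewrite leqNgt ib.
have Giter i x : G x -> G (iter i T x).
  by move=> Gx; elim: i => //= i IH; apply/GT.
have fiter i x : G x -> f (iter i T x) = lam ^+ i * f x.
  move=> Gx; elim: i => [|i IH]; first by rewrite mul1r.
  by rewrite iterS fT ?IH ?exprS ?mulrA//; exact: Giter.
have GiterE i x : G (iter i T x) <-> G x.
  by elim: i => //= i IH; split=> [/GT/IH|/IH/GT].
exists (A j); split=> //.
- move=> x; rewrite /A; split=> -[Gx Sx].
    have Gx' : G x by move/GiterE: Gx.
    by split=> //; move: Sx => /=; rewrite fiter// lamb mul1r.
  by split; [exact: Giter|rewrite /= fiter// lamb mul1r].
(* With r the remainder of i modulo b and z = [lam ^+ j * f x], both z and [lam ^+ r * z] are in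
   [S0]. If 0 < r, rotating by r and then by b - r makes each smaller than the other. *)
- move=> i x [Gx Sx] [_]; rewrite /= fiter// mulrA [_ * lam ^+ i]mulrC -mulrA.
  rewrite -(expr_mod i lamb) => Six.
  apply: contraT; rewrite /dvdn -lt0n => r0.
  have rb : (i %% b < b)%N by rewrite ltn_mod.
  have := Sx (i %% b)%N; rewrite r0 rb => /(_ isT) h1.
  have := Six (b - i %% b)%N; rewrite subn_gt0 rb ltn_subrL r0 b0 => /(_ isT).
  rewrite mulrA -exprD subnK ?lamb ?mul1r; last exact: ltnW.
  by move=> h2; case: (lexlt_asym h1 h2).
Qed.

End EigenCyclic.

(** * Bases of towers and classes modulo the period *)

Section Towers.
Variables (R : realType) (B : ordered_bratteli) (d : nat) (q : nat -> nat).
Variables (T : path_space B -> path_space B).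
Variables (mu : probability (path_space B) R).
Variable lab : forall n, 'I_d -> vertex B n.+1.
Hypothesis Btoeplitz : toeplitz_type B q.
Hypothesis Bord : properly_ordered B.
Hypothesis Tvershik : vershik_map T.
Hypothesis lab_bij : forall n, bijective (lab n).
Hypothesis mT : measurable_fun setT T.
Hypothesis Tinv : invariant_measure T mu.
Variables (b : nat) (A : set (path_space B)).
Hypothesis b_gt0 : (0 < b)%N.
Hypothesis cyA : cyclic_set mu T b A.

Local Notation m := (rmeas mu).
Let Ai i := [set x | A (iter i T x)].

Let mA : measurable A. Proof. by case: cyA. Qed.

Let mAi i : measurable (Ai i).
Proof. exact: measurable_iter. Qed.

Let Ai_mod i j : i = j %[mod b] -> Ai i = Ai j.
Proof.
move=> ij; apply/seteqP; suff h : forall u v, u = v %[mod b] -> Ai u `<=` Ai v.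
  by split; exact: h.
move=> u v uv x; rewrite /Ai/= (divn_eq u b) iterD.
move=> /(cyclic_iterM _ _ cyA); rewrite uv {2}(divn_eq v b) iterD => ?.
exact/(cyclic_iterM _ _ cyA).
Qed.

Let Ai_disjoint i j x : Ai i x -> Ai j x -> i = j %[mod b].
Proof.
wlog ij : i j / (i <= j)%N.
  by move=> h Ax Ax'; case/orP: (leq_total i j) => ?; [|symmetry]; exact: h.
have [_ _ _ cA] := cyA.
move=> Ax; rewrite /Ai/= -(subnK ij) iterD => /(cA _ _ Ax) /dvdnP[k ->].
by rewrite modnMDl.
Qed.

Section Level.
Variable n : nat.
Let p := pseq q n.+1.

Definition tower_floor (j : nat) (t : 'I_d) : set (path_space B) :=
  [set x | tower_pos q n.+1 x = j /\ tgt (sval x n) = lab n t].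

Lemma tower_floor_level j t : level_set n.+1 (tower_floor j t).
Proof.
move=> x [px tx] y xy; split; last by rewrite xy.
by rewrite -px; apply: eq_bigr => k _; rewrite xy.
Qed.

(** Position and end-point determine the first n + 1 edges, so a floor is empty or a single
    cylinder. *)
Lemma tower_floor_sub_level U j t : level_set n.+1 U ->
  tower_floor j t `<=` U \/ tower_floor j t `&` U = set0.
Proof.
move=> lU; have [[x [[px tx] Ux]]|/forallNP h] := pselect (tower_floor j t `&` U !=set0).
  left=> y [py ty]; apply: lU Ux _ _ => k; rewrite ltnS => kn.
  by apply: (tower_pos_tgt_inj Btoeplitz _ _ kn); rewrite ?px ?tx.
by right; apply/seteqP; split=> // x /h.
Qed.

Let mfloor j t : measurable (tower_floor j t).
Proof. exact: level_set_measurable (@tower_floor_level j t). Qed.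

Let mpos j : measurable [set x : path_space B | tower_pos q n.+1 x = j].
Proof.
apply: (@level_set_measurable _ n.+1) => x px y xy.
by rewrite /= -px; apply: eq_bigr => k _; rewrite xy.
Qed.

(** Above the base, the preimage of a floor is the floor just below it in the same tower; invariance
    of [mu] does the rest. *)
Lemma rmeas_floorS P j t : measurable P -> (j.+1 < p)%N ->
  m (P `&` tower_floor j.+1 t) = m (T @^-1` P `&` tower_floor j t).
Proof.
move=> mP jp; rewrite -(rmeas_preimageT Tinv); last exact: measurableI.
rewrite preimage_setI; congr (m (_ `&` _)).
have vs := vershik_step Btoeplitz Bord Tvershik n.+1.
apply/seteqP; split=> x [px tx]; case: (vs x) => -[h1 h2].
- by rewrite h2 in px.
- by move=> /(_ n erefl) h3; split; [rewrite h2 in px; case: px|rewrite -h3].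
- by move: jp; rewrite -px h1 ltnn.
- by move=> /(_ n erefl) h3; split; [rewrite h2 px|rewrite h3].
Qed.

Lemma rmeas_floor i j t : (j < p)%N ->
  m (Ai i `&` tower_floor j t) = m (Ai (i + j) `&` tower_floor 0 t).
Proof.
elim: j i => [|j IH] i jp; first by rewrite addn0.
rewrite rmeas_floorS// addnS -addSn -IH; last exact: ltnW.
by congr (m (_ `&` _)); apply/seteqP; split=> x; rewrite /Ai/= -iterSr.
Qed.

Lemma rmeas_floor0 j t : (j < p)%N -> m (tower_floor j t) = m (tower_floor 0 t).
Proof.
elim: j => // j IH jp; rewrite -IH; last exact: ltnW.
by have := rmeas_floorS t measurableT jp; rewrite preimage_setT !setTI.
Qed.

Let posI x : 'I_p := Ordinal (tower_pos_lt Btoeplitz n.+1 x).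

Let posIE x (j : 'I_p) : posI x = j <-> tower_pos q n.+1 x = j.
Proof. by split=> [<-//|h]; exact: val_inj. Qed.

Let labelP : exists tau : path_space B -> 'I_d,
  forall x t, tau x = t <-> tgt (sval x n) = lab n t.
Proof.
case: (lab_bij n) => g gK Kg; exists (fun x => g (tgt (sval x n))) => x t.
by split=> [<-|->]; rewrite ?Kg ?gK.
Qed.

Let mtau t : measurable (tau_event lab n t).
Proof.
by apply: (@level_set_measurable _ n.+1) => x tx y xy; rewrite /tau_event/= xy.
Qed.

Let rmeas_posI P : measurable P ->
  m P = \sum_(j < p) m (P `&` [set x | tower_pos q n.+1 x = j]).
Proof.
move=> mP.
have posIS j : [set x | posI x = j] = [set x | tower_pos q n.+1 x = j].
  by apply/seteqP; split=> x /posIE.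
rewrite (@rmeas_partition _ _ _ mu _ posI)// => [|j]; last by rewrite posIS.
by apply: eq_bigr => j _; rewrite posIS.
Qed.

Lemma rmeas_label P : measurable P ->
  m P = \sum_(t < d) m (P `&` tau_event lab n t).
Proof.
move=> mP; have [tau tauE] := labelP.
have tauS t : [set x | tau x = t] = tau_event lab n t.
  by apply/seteqP; split=> x /tauE.
rewrite (@rmeas_partition _ _ _ mu _ tau)// => [|j]; last by rewrite tauS.
by apply: eq_bigr => j _; rewrite tauS.
Qed.

Let floorE j t :
  tower_floor j t = [set x | tower_pos q n.+1 x = j] `&` tau_event lab n t.
Proof. by []. Qed.

Let rmeas_floors P : measurable P ->
  m P = \sum_(t < d) \sum_(j < p) m (P `&` tower_floor j t).
Proof.
move=> mP; rewrite rmeas_label//; apply: eq_bigr => t _.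
rewrite rmeas_posI; last exact: measurableI.
by apply: eq_bigr => j _; rewrite floorE -setIA [_ `&` tau_event _ _ _]setIC.
Qed.

Lemma rmeas_tau t : m (tau_event lab n t) = p%:R * m (tower_floor 0 t).
Proof.
rewrite rmeas_posI// (eq_bigr (fun _ => m (tower_floor 0 t))).
  by rewrite sumr_const card_ord mulr_natl.
by move=> j _; rewrite setIC -floorE rmeas_floor0.
Qed.

(* The measure of the part of T^-i A in the union of the bases of all towers. *)
Let base i := \sum_(t < d) m (Ai i `&` tower_floor 0 t).

Let baseE i j : (j < p)%N ->
  base (i + j) = m (Ai i `&` [set x | tower_pos q n.+1 x = j]).
Proof.
move=> jp; rewrite [RHS]rmeas_label; last exact: measurableI.
by apply: eq_bigr => t _; rewrite -setIA -floorE (rmeas_floor i t jp).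
Qed.

(** The preimage of the union of the bases is the union of the top floors, at height p - 1. This
    holds for the union only: an orbit leaving the top of one tower may enter the base of
    another. *)
Let baseDp i : base (i + p) = base i.
Proof.
have p0 : (0 < p)%N := pseq_gt0 Btoeplitz n.+1.
have -> : (i + p = i.+1 + p.-1)%N by rewrite addSn -addnS prednK.
rewrite -[in RHS](addn0 i) !baseE ?prednK//.
rewrite -(rmeas_preimageT Tinv (A := _ `&` [set x | _ = 0%N])); last first.
  exact: measurableI.
rewrite preimage_setI; congr (m (_ `&` _)).
  by apply/seteqP; split=> x; rewrite /Ai/= -iterSr.
have vs := vershik_step Btoeplitz Bord Tvershik n.+1.
apply/seteqP; split=> x /= px; case: (vs x).
- by case.
- by case; rewrite px prednK// ltnn.
- by case => h1 _; rewrite /p -h1.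
- by case => _ h2; rewrite h2 in px.
Qed.

Let baseDMp i k : base (i + k * p) = base i.
Proof.
elim: k => [|k IH]; first by rewrite addn0.
by rewrite mulSn [(p + _)%N]addnC addnA baseDp.
Qed.

(** Slicing [A] by height writes [m A] as the sum of the p numbers [base j], j < p; one of them is
    at least the average. *)
Let base_big : exists i, m A <= p%:R * base i.
Proof.
apply: contrapT => /forallNP h.
have p0 : 0 < p%:R :> R by rewrite ltr0n (pseq_gt0 Btoeplitz).
have : p%:R * m A < p%:R * m A.
  rewrite {1}(rmeas_posI mA) mulr_sumr.
  rewrite [ltRHS](_ : _ = \sum_(j < p) m A); last first.
    by rewrite sumr_const card_ord mulr_natl.
  apply: ltr_sum => [|j _].
    apply/hasP; exists (Ordinal (pseq_gt0 Btoeplitz n.+1)); last by [].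
    by rewrite mem_index_enum.
  by have := h (0 + j)%N; rewrite baseE// => /negP; rewrite -ltNge.
by rewrite ltxx.
Qed.

Variable J : {set 'I_d}.
Hypothesis J_small : \sum_(t | t \notin J) m (tau_event lab n t) < m A / 2.
Variable U : nat -> set (path_space B).
Hypothesis U_level : forall i, (i < b)%N -> level_set n.+1 (U i).
Hypothesis U_approx : forall i, (i < b)%N ->
  sdist mu (Ai i) (U i) <= m A / 2 / b%:R.

Let D i := (Ai i `\` U i) `|` (U i `\` Ai i).

Let mD i : (i < b)%N -> measurable (D i).
Proof.
move=> ib; have mU := level_set_measurable (U_level ib).
by apply: measurableU; exact: measurableD.
Qed.

Let D_small i : (i < b)%N -> m (D i) <= m A / 2 / b%:R.
Proof.
move=> ib; apply: le_trans (U_approx ib).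
have mU := level_set_measurable (U_level ib).
by apply: rmeasU_le; exact: measurableD.
Qed.

(** A floor disjoint from [U i] has its whole trace of T^-i A in the error [D i]. A floor inside
    [U i] has the complement of that trace in [D i], and this complement is at least as large as the
    trace. *)
Let floor_half i j t : (i < b)%N ->
  m (Ai i `&` tower_floor j t) <= m (tower_floor j t) / 2 ->
  m (Ai i `&` tower_floor j t) <= m (D i `&` tower_floor j t).
Proof.
move=> ib half; have mDf : measurable (D i `&` tower_floor j t).
  by apply: measurableI => //; exact: mD.
have [fU|fU] := tower_floor_sub_level j t (U_level ib).
  have h := rmeas_split mu (mfloor j t) (mAi i).
  have : m (tower_floor j t `\` Ai i) <= m (D i `&` tower_floor j t).
    apply: le_rmeas => //; first exact: measurableD.
    by move=> x [fx nAx]; split=> //; right; split=> //; exact: fU.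
  rewrite setIC in half *; lra.
apply: le_rmeas => //; first exact: measurableI.
move=> x [Ax fx]; split=> //; left; split=> // Ux.
by have : (tower_floor j t `&` U i) x by []; rewrite fU.
Qed.

(* Otherwise, on every floor of a tower of J, the trace of T^-i A (where i plus
   the height of the floor is v modulo b) would be at most half of the floor,
   hence contained in the error made when T^-i A is replaced by a union of floors. *)
Let base_majority v : m A <= p%:R * base v ->
  exists2 t, t \in J & m (tower_floor 0 t) / 2 < m (Ai v `&` tower_floor 0 t).
Proof.
move=> vbig; apply: contrapT => noI.
have half t : t \in J -> m (Ai v `&` tower_floor 0 t) <= m (tower_floor 0 t) / 2.
  by move=> tI; rewrite leNgt; apply/negP => h; apply: noI; exists t.
suff : p%:R * base v < m A by rewrite ltNge vbig.
(* One half of [m A] bounds the towers of [J], through the b errors [D i]; the other half bounds the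
   remaining towers, strictly, by [J_small]. *)
rewrite /base (bigID (fun t => t \in J))/= mulrDr [ltRHS]splitr.
apply: ler_ltD; last first.
  apply: le_lt_trans J_small; rewrite mulr_sumr; apply: ler_sum => t _.
  rewrite rmeas_tau ler_wpM2l//.
  by apply: le_rmeas; [exact: measurableI| |move=> x []].
have bn0 : b%:R != 0 :> R by rewrite pnatr_eq0 -lt0n.
apply: (@le_trans _ _ (\sum_(i < b) m (D i))); last first.
  apply: (@le_trans _ _ (\sum_(i < b) m A / 2 / b%:R)).
    by apply: ler_sum => i _; exact: D_small.
  by rewrite sumr_const card_ord -[leLHS]mulr_natr divfK.
rewrite mulr_sumr.
rewrite [leRHS](_ : _ =
    \sum_(i < b) \sum_(t < d) \sum_(j < p) m (D i `&` tower_floor j t)); last first.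
  by apply: eq_bigr => i _; apply: rmeas_floors; exact: mD.
rewrite [leRHS]exchange_big/= [leLHS]big_mkcond/=; apply: ler_sum => t _.
case: ifPn => [tI|_]; last by do 2 apply: sumr_ge0 => ? _; exact: rmeas_ge0.
(* The p copies of the trace on the base of [t] are distributed over the p floors of its tower, each
   charged to a single error on its own floor. *)
rewrite exchange_big/= [leLHS](_ : _ =
    \sum_(j < p) m (Ai v `&` tower_floor 0 t)); last first.
  by rewrite sumr_const card_ord mulr_natl.
apply: ler_sum => j _.
(* As b - 1 is -1 modulo b, this [i] is the class with i + j congruent to v. *)
pose i := ((v + j * b.-1) %% b)%N.
have ib : (i < b)%N by rewrite ltn_mod.
have aE : m (Ai v `&` tower_floor 0 t) = m (Ai i `&` tower_floor j t).
  rewrite (rmeas_floor i t (ltn_ord j)); congr (m (_ `&` _)); apply: Ai_mod.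
  rewrite /i modnDml -addnA -mulnSr prednK// addnC modnMDl//.
rewrite aE (bigD1 (Ordinal ib))//= -[leLHS]addr0; apply: lerD.
  by apply: floor_half => //; rewrite -aE rmeas_floor0// half.
by apply: sumr_ge0 => ? _; exact: rmeas_ge0.
Qed.

Lemma cyclic_level_bound : (b %/ gcdn b p <= #|J|)%N.
Proof.
have [i0 i0big] := base_big; set c := (b %/ gcdn b p)%N.
have /choice[t tP] : forall k : 'I_c, exists t : 'I_d, t \in J /\
    m (tower_floor 0 t) / 2 < m (Ai (i0 + k * p) `&` tower_floor 0 t).
  move=> k; have [|t ? ?] := @base_majority (i0 + k * p)%N; last by exists t.
  by rewrite baseDMp.
have g0 : (0 < gcdn b p)%N by rewrite gcdn_gt0 b_gt0.
have t_inj : injective t.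
  move=> k k' tkk'; have [_ h] := tP k; have [_] := tP k'; rewrite -tkk' => h'.
  suff : (i0 + k * p = i0 + k' * p %[mod b])%N.
    (* Congruence gives that b divides (k' - k) p, hence also (k' - k) gcd(b, p). So [c] divides k'
       - k, which is less than [c], and k = k'. *)
    wlog kk' : k k' tkk' h h' / (k <= k')%N.
      move=> H; case/orP: (leq_total k k') => ? ?; [|symmetry];
        by apply: H => //; rewrite -?tkk'.
    move=> /esym/eqP; rewrite eqn_mod_dvd ?leq_add2l ?leq_mul2r ?kk' ?orbT//.
    rewrite subnDl -mulnBl => bd.
    have : (b %| (k' - k) * gcdn b p)%N by rewrite muln_gcdr dvdn_gcd dvdn_mull.
    rewrite -{1}(divnK (dvdn_gcdl b p)) dvdn_pmul2r// => /dvdnP[[|r] E].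
      by apply/val_inj/eqP; rewrite /= eqn_leq kk' -subn_eq0 E.
    have := ltn_ord k'; rewrite ltnNge => /negP; case.
    by apply: leq_trans (leq_subr k k'); rewrite E mulSn leq_addr.
  (* If the two sets meet, their indices agree modulo b. If not, two disjoint sets would each fill
     more than half of the same base. *)
  have [[x [Ax Ax']]|/forallNP disj] :=
      pselect (Ai (i0 + k * p) `&` Ai (i0 + k' * p) !=set0).
    exact: Ai_disjoint Ax Ax'.
  exfalso; move: h h'; set P := Ai _ `&` _; set P' := Ai _ `&` _ => h h'.
  have mP : measurable P by exact: measurableI.
  have mP' : measurable P' by exact: measurableI.
  have := @le_rmeas _ _ _ mu (P `|` P') (tower_floor 0 (t k)).
  rewrite rmeasU//; last first.
    by apply/seteqP; split=> // x [[? _] [? _]]; apply: (disj x).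
  have sub : P `|` P' `<=` tower_floor 0 (t k) by move=> x [[]|[]].
  move=> /(_ (measurableU _ _ mP mP') (mfloor _ _) sub); lra.
rewrite -[c]card_ord -(card_imset _ t_inj).
apply/subset_leq_card/fintype.subsetP.
by move=> _ /imsetP[k _ ->]; case: (tP k).
Qed.

End Level.
End Towers.

(** * The limit of b / gcd(b, p_m) *)

Section Period.
Variable q : nat -> nat.

Definition reduced_period (b : nat) : nat :=
  limn (fun n => (b %/ gcdn b (pseq q n))%N).

(** These gcds are at most b, and each divides the next; they are constant from the index where the
    largest value is reached. *)
Lemma gcd_pseq_stable b : (0 < b)%N -> exists N, forall n, (N <= n)%N ->
  gcdn b (pseq q n) = gcdn b (pseq q N).
Proof.
move=> b0; pose P v := `[< exists n, gcdn b (pseq q n) = v >].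
have exP : exists v, P v.
  by exists (gcdn b (pseq q 0)); apply/asboolP; exists 0%N.
have Pb v : P v -> (v <= b)%N.
  by move=> /asboolP[n <-]; rewrite dvdn_leq ?dvdn_gcdl.
case: (ex_maxnP exP Pb) => v /asboolP[N <-] Nmax; exists N => n Nn.
apply/eqP; rewrite eqn_leq Nmax/=; last by apply/asboolP; exists n.
apply: dvdn_leq; first by rewrite gcdn_gt0 b0.
rewrite dvdn_gcd dvdn_gcdl/= (dvdn_trans (dvdn_gcdr _ _))//.
elim: n Nn => [|n IH]; first by rewrite leqn0 => /eqP ->.
rewrite leq_eqVlt => /predU1P[->//|/IH h]; apply: dvdn_trans h _.
by rewrite pseqS dvdn_mulr.
Qed.

Lemma reduced_periodE b : (0 < b)%N -> exists N, forall n, (N <= n)%N ->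
  reduced_period b = (b %/ gcdn b (pseq q n))%N.
Proof.
move=> b0; have [N NP] := gcd_pseq_stable b0; exists N => n Nn.
apply: lim_near_cst; first exact: order_hausdorff.
by exists N => // k /= Nk; rewrite !NP.
Qed.

Lemma reduced_period_gt0 b : (0 < b)%N -> (0 < reduced_period b)%N.
Proof.
move=> b0; have [N NP] := reduced_periodE b0; rewrite (NP N)//.
by rewrite divn_gt0 ?gcdn_gt0 ?b0// dvdn_leq ?dvdn_gcdl.
Qed.

(** At a level p where both sequences have stabilized, the claim amounts to b gcd(c, p) dividing c
    gcd(b, p). *)
Lemma reduced_period_dvd b c : (0 < c)%N -> (b %| c)%N ->
  (reduced_period b %| reduced_period c)%N.
Proof.
move=> c0 bc; have b0 := dvdn_gt0 c0 bc.
have [N NP] := reduced_periodE b0; have [M MP] := reduced_periodE c0.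
have [hN hM] := (NP _ (leq_maxl N M), MP _ (leq_maxr N M)).
rewrite {}hN {}hM; set p := pseq q _.
have gb : (0 < gcdn b p)%N by rewrite gcdn_gt0 b0.
have gc : (0 < gcdn c p)%N by rewrite gcdn_gt0 c0.
rewrite -(dvdn_pmul2r gb) divnK ?dvdn_gcdl// -(dvdn_pmul2r gc).
rewrite mulnAC divnK ?dvdn_gcdl// !muln_gcdr dvdn_gcd [(c * b)%N]mulnC.
by rewrite dvdn_gcdl (dvdn_trans (dvdn_gcdr _ _))// dvdn_mul.
Qed.

End Period.

(** * The bound of reduced periods by the number of non-vanishing labels *)

Section Bound.
Variables (R : realType) (B : ordered_bratteli) (d : nat) (q : nat -> nat).
Variables (T : path_space B -> path_space B).
Variables (mu : probability (path_space B) R).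
Variable lab : forall n, 'I_d -> vertex B n.+1.
Hypothesis Btoeplitz : toeplitz_type B q.
Hypothesis Bord : properly_ordered B.
Hypothesis Tvershik : vershik_map T.
Hypothesis lab_bij : forall n, bijective (lab n).
Variable J : {set 'I_d}.
Hypothesis J_lim : forall t, t \notin J ->
  mu (tau_event lab n t) @[n --> \oo] --> 0%E.

Lemma eventually_small (e : R) : 0 < e -> exists N, forall n, (N <= n)%N ->
  \sum_(t | t \notin J) rmeas mu (tau_event lab n t) < e.
Proof.
(* Dividing by d + 1 keeps the sum of at most d terms strictly below e, and covers d = 0. *)
move=> e0; pose e' := e / d.+1%:R.
have e'0 : 0 < e' by rewrite divr_gt0.
have /choice[N NP] : forall t : 'I_d, exists N, t \notin J ->
    forall n, (N <= n)%N -> rmeas mu (tau_event lab n t) <= e'.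
  move=> t; case: (boolP (t \in J)) => [tJ|tJ]; first by exists 0%N.
  have /fine_cvgP[_ /cvgrPdist_le /(_ e' e'0) [N _ NP]] := J_lim tJ.
  exists N => _ n Nn; have := NP n Nn; rewrite sub0r normrN.
  exact: le_trans (ler_norm _).
exists (\max_t N t)%N => n Nn.
apply: (@le_lt_trans _ _ (\sum_(t < d) e')).
  rewrite big_mkcond; apply: ler_sum => t _.
  case: ifPn => [tJ|_]; last exact: ltW.
  by apply: (NP t tJ); apply: leq_trans Nn; exact: leq_bigmax.
rewrite sumr_const card_ord -[ltLHS]mulr_natr /e' mulrAC ltr_pdivrMr ?ltr0n//.
by rewrite ltr_pM2l// ltr_nat.
Qed.

(** If [J] were empty, the measures of all tower events would sum to less than 1 at some level,
    whereas these events partition the space. *)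
Lemma card_nonvanishing_gt0 : (0 < #|J|)%N.
Proof.
rewrite lt0n cards_eq0; apply/eqP => J0.
have [N /(_ N (leqnn N))] := eventually_small ltr01.
rewrite J0 (eq_bigl xpredT) => [|t]; last by rewrite finset.in_set0.
have := rmeas_label mu lab_bij N measurableT; rewrite rmeasT => E.
under eq_bigr => t _ do rewrite -(setTI (tau_event lab N t)).
by rewrite -E ltxx.
Qed.

Hypothesis mT : measurable_fun setT T.
Hypothesis Tinv : invariant_measure T mu.

Lemma cyclic_bound b A : (0 < b)%N -> cyclic_set mu T b A ->
  (reduced_period q b <= #|J|)%N.
Proof.
move=> b0 cyA; have [mA A_gt0 _ _] := cyA.
have [N1 N1P] := reduced_periodE q b0.
have A2_gt0 : 0 < rmeas mu A / 2 by rewrite divr_gt0.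
have [N2 N2P] := eventually_small A2_gt0.
have e0 : 0 < rmeas mu A / 2 / b%:R by rewrite divr_gt0 ?ltr0n.
have /choice[N3 N3P] : forall i : nat, exists N, exists U,
    level_set N U /\
    sdist mu [set x | A (iter i T x)] U <= rmeas mu A / 2 / b%:R.
  move=> i; have [|N [U [lU AU]]] :=
    @measurable_approximable _ _ mu [set x | A (iter i T x)] _ _ e0.
    exact: measurable_iter.
  by exists N, U; split=> //; exact: ltW.
have /choice[U UP] := N3P.
(* The level must stabilize the gcd, make the towers outside [J] small, and resolve the
   approximations of all T^-i A for i < b. *)
pose n := maxn (maxn N1 N2) (\max_(i < b) N3 i).
rewrite (N1P n.+1); last by rewrite leqW// !leq_max leqnn.
apply: (@cyclic_level_bound _ _ _ _ _ mu lab Btoeplitz Bord Tvershik lab_bij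
  mT Tinv b A b0 cyA n J _ U).
- by apply: N2P; rewrite !leq_max leqnn orbT.
- move=> i ib; case: (UP i) => lU _; apply: level_setW lU; apply: leqW.
  by rewrite leq_max (leq_trans _ (leq_bigmax (Ordinal ib))) ?orbT.
- by move=> i _; case: (UP i).
Qed.

End Bound.

(** * Continuity, divisibility, counting and the conclusion *)

Lemma continuous_path_measurable (B : bratteli)
    (T : path_space B -> path_space B) :
  continuous T -> measurable_fun setT T.
Proof.
move=> /continuousP cT; apply: (measurability (@open (path_space B))) => //.
by move=> _ [U oU <-]; rewrite setTI; apply: open_measurable_path; exact: cT.
Qed.

Lemma continuous_eigenvalueX (R : realType) (X : topologicalType) (T : X -> X)
    (lam : R[i]) k :
  continuous_eigenvalue T lam -> continuous_eigenvalue T (lam ^+ k).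
Proof.
move=> [f [cf [x0 fx0] fT]]; exists (fun x => f x ^+ k); split.
- elim: k => [|k IH]; first exact: cst_continuous.
  rewrite (_ : (fun x => f x ^+ k.+1) = (fun x => f x * f x ^+ k)); last first.
    by apply/funext => x; rewrite exprS.
  by move=> x; apply: cvgM; [exact: cf|exact: IH].
- by exists x0; rewrite expf_neq0.
- by move=> x; rewrite fT exprMn.
Qed.

(** The numerically largest element c is a multiple of every a in A: a common multiple of a and c in
    A is at least c, hence equal to it. *)
Lemma directed_div_maximal (A : set nat) M : A !=set0 ->
  (forall a, A a -> (0 < a <= M)%N) ->
  (forall a b, A a -> A b -> exists c, [/\ A c, (a %| c)%N & (b %| c)%N]) ->
  exists! c, div_maximal A c.
Proof.
move=> [a0 Aa0] AM Adir.
have exA : exists a, `[< A a >] by exists a0; exact/asboolP.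
have Ab a : `[< A a >] -> (a <= M)%N by move=> /asboolP/AM/andP[].
case: (ex_maxnP exA Ab) => c /asboolP Ac cmax.
have cdiv a : A a -> (a %| c)%N.
  move=> Aa; have [e [Ae ce ae]] := Adir _ _ Ac Aa.
  have /andP[e0 _] := AM _ Ae.
  suff -> : c = e by [].
  by apply/eqP; rewrite eqn_leq dvdn_leq//= cmax//; exact/asboolP.
exists c; split.
  split=> // a Aa ca; apply/eqP; rewrite eqn_dvd ca andbT; exact: cdiv.
by move=> a [Aa amax]; apply: amax => //; exact: cdiv.
Qed.

Lemma sum_card_disjoint (M : choiceType) (d : nat) (I : M -> {set 'I_d})
    (s : seq M) :
  uniq s ->
  (forall x y, x \in s -> y \in s -> x <> y ->
     forall t, ~~ ((t \in I x) && (t \in I y))) ->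
  (\sum_(x <- s) #|I x| <= d)%N.
Proof.
move=> us dI.
suff -> : (\sum_(x <- s) #|I x|)%N = #|[pred t | has (fun x => t \in I x) s]|.
  by rewrite -[leqRHS](card_ord d) max_card.
elim: s us dI => [_ _|x s IH /= /andP[xs us] dI].
  by rewrite big_nil; apply/esym/eq_card0 => t; rewrite !inE.
rewrite big_cons IH//; last first.
  by move=> y z ys zs; apply: dI; rewrite inE ?ys ?zs orbT.
rewrite -cardUI [X in (_ + X)%N]eq_card0 ?addn0.
  by apply: eq_card => t; rewrite !inE.
move=> t; rewrite !inE; apply/negP => /andP[tx /hasP[y ys ty]].
have : ~~ ((t \in I x) && (t \in I y)).
  apply: dI; rewrite ?inE ?eqxx ?ys ?orbT// => xy.
  by rewrite xy ys in xs.
by rewrite tx ty.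
Qed.

Theorem corollary7 (R : realType) (B : ordered_bratteli) (d : nat)
    (q : nat -> nat)
    (T : path_space B -> path_space B)
    (lab : forall n, 'I_d -> vertex B n.+1)
    (I : probability (path_space B) R -> {set 'I_d})
    (Bproper : proper_of_rank B d)
    (Btoeplitz : toeplitz_type B q)
    (Tvershik : vershik_map T)
    (Tminimal : minimal_cantor_system T)
    (lab_bij : forall n, bijective (lab n))
    (Iclean : clean T lab I) :
  let Merg : set (probability (path_space B) R) := ergodic_measures T in
  let M : set (probability (path_space B) R) := noncont_measures T q in
  let bmax (mu : probability (path_space B) R) := div_max (Bset T q mu) in
  [/\ forall mu, M mu -> forall b, Bset T q mu b -> (b <= #|I mu|)%N,
      forall mu, M mu -> exists! b, div_maximal (Bset T q mu) b,
      finite_set M /\ (\sum_(mu \in M) bmax mu <= d)%N &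
      [/\ finite_set Merg,
          (#|` fset_set M| <= #|` fset_set Merg|)%N &
          (#|` fset_set Merg|%:Z <=
             d%:Z - \sum_(mu \in M) ((bmax mu)%:Z - 1))]].
Proof.
move=> Merg M bmax.
have [Bord _ _ _ _] := Bproper.
have [_ [S [TK _ cT cS]] _] := Tminimal.
have [mT mS] := (continuous_path_measurable cT, continuous_path_measurable cS).
have [[delta _ Ilim] Idisj] := Iclean.
have Ivanish mu : Merg mu -> forall t, t \notin I mu ->
    mu (tau_event lab n t) @[n --> \oo] --> 0%E.
  by move=> /Ilim[].
have Bbound mu a : Merg mu -> Bset T q mu a -> (0 < a <= #|I mu|)%N.
  move=> Emu [b [b0 [bev _]] <-]; have [_ Tinv _] := Emu.
  have [A cyA] := eigenvalue_cyclic mT Tinv mS TK b0 bev.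
  rewrite -/(reduced_period q b) reduced_period_gt0//=.
  exact: (cyclic_bound Btoeplitz Bord Tvershik lab_bij (Ivanish _ Emu) mT Tinv
    b0 cyA).
have Bdir mu a1 a2 : Merg mu -> Bset T q mu a1 -> Bset T q mu a2 ->
    exists c, [/\ Bset T q mu c, (a1 %| c)%N & (a2 %| c)%N].
  move=> [_ Tinv Terg] [b1 [b10 [ev1 nc1]] <-] [b2 [b20 [ev2 _]] <-].
  have [A1 cy1] := eigenvalue_cyclic mT Tinv mS TK b10 ev1.
  have [A2 cy2] := eigenvalue_cyclic mT Tinv mS TK b20 ev2.
  have [A cyA] := cyclic_lcm mT Terg b20 cy1 cy2.
  have l0 : (0 < lcmn b1 b2)%N by rewrite lcmn_gt0 b10.
  exists (reduced_period q (lcmn b1 b2)).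
  split; [|exact: reduced_period_dvd (dvdn_lcml _ _)|
    exact: reduced_period_dvd (dvdn_lcmr _ _)].
  exists (lcmn b1 b2) => //; split=> //; split.
    exact: (cyclic_eigenvalue mT l0 cyA).
  (* The eigenvalue of order [b1] is a power of the one of order lcm(b1, b2), so continuity of the
     latter would contradict [nc1]. *)
  move=> cev; apply: nc1; rewrite -(exp2ipi_dvd R l0 (dvdn_lcml b1 b2)).
  exact: continuous_eigenvalueX.
have Bmax mu : M mu -> exists! c, div_maximal (Bset T q mu) c.
  move=> [Emu B0]; apply: (@directed_div_maximal _ #|I mu|) => // [a|a1 a2].
    exact: Bbound.
  exact: Bdir.
have bmax_le mu : M mu -> (bmax mu <= #|I mu|)%N.
  move=> Mmu; have [c [cmax _]] := Bmax _ Mmu.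
  (* Existence of a maximal element ensures that [xget] returns one, and not its default 0. *)
  have [Bc _] : div_maximal (Bset T q mu) (bmax mu).
    exact: (xgetPex 0%N (ex_intro _ c cmax)).
  by have [Emu _] := Mmu; case/andP: (Bbound _ _ Emu Bc).
have sum_le (s : seq (probability (path_space B) R)) :
    uniq s -> {subset s <= Merg} -> (\sum_(mu <- s) #|I mu| <= d)%N.
  move=> us sE; apply: sum_card_disjoint => // mu nu.
  move=> /sE/set_mem Emu /sE/set_mem Enu.
  exact: Idisj.
have I_gt0 mu : Merg mu -> (0 < #|I mu|)%N.
  by move=> Emu; exact: (card_nonvanishing_gt0 lab_bij (Ivanish _ Emu)).
have size_le (s : seq (probability (path_space B) R)) :
    {subset s <= Merg} -> (size s <= \sum_(mu <- s) #|I mu|)%N.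
  move=> sE; rewrite -sum1_size big_seq [leqRHS]big_seq.
  apply: leq_sum => mu /sE/set_mem.
  exact: I_gt0.
(* Among infinitely many ergodic measures, d + 1 could be chosen, with nonempty disjoint label sets
   inside a set of d labels. *)
have finE : finite_set Merg.
  apply: contrapT => /(infinite_set_fset d.+1)[s sE].
  have sE' : {subset (s : seq _) <= Merg} by move=> mu /sE/mem_set.
  by rewrite ltnNge (leq_trans (size_le _ sE') (sum_le _ (fset_uniq s) sE')).
have ME : M `<=` Merg by move=> mu [].
have finM : finite_set M := sub_finite_set ME finE.
set sM := fset_set M; set sE := fset_set Merg.
have sMP mu : mu \in sM -> M mu by rewrite in_fset_set// => /set_mem.
have sEP mu : mu \in sE -> Merg mu by rewrite in_fset_set// => /set_mem.
have sME : (sM `<=` sE)%fset by rewrite -fset_set_sub.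
have cardE : (#|` sE| = #|` sM| + #|` (sE `\` sM)%fset|)%N.
  by rewrite -(cardfsID sM sE); congr (#|` _| + _)%N; apply/fsetIidPr.
(* Both (3) and (4) follow from this count: a measure in [M] uses at least [bmax mu] labels, any
   other ergodic measure at least one. *)
have total : (\sum_(mu <- sM) bmax mu + #|` (sE `\` sM)%fset| <= d)%N.
  pose s : seq (probability (path_space B) R) :=
    (sM : seq _) ++ (sE `\` sM)%fset.
  have us : uniq s.
    rewrite cat_uniq !fset_uniq/= andbT; apply/hasPn => mu.
    by rewrite in_fsetD => /andP[].
  have sE' : {subset s <= Merg}.
    move=> mu; rewrite mem_cat => /orP[/sMP/ME/mem_set//|].
    by rewrite in_fsetD => /andP[_ /sEP/mem_set].
  apply: leq_trans (sum_le s us sE'); rewrite big_cat/=; apply: leq_add.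
    rewrite big_seq [leqRHS]big_seq; apply: leq_sum => mu /sMP.
    exact: bmax_le.
  by apply: size_le => mu mus; apply: sE'; rewrite mem_cat mus orbT.
split.
- by move=> mu [Emu _] b /(Bbound _ _ Emu)/andP[].
- exact: Bmax.
- split=> //; rewrite fsbig_finite//; apply: leq_trans total; exact: leq_addr.
- split=> //; first exact: fsubset_leq_card.
  rewrite fsbig_finite//= -/sM.
  have -> : \sum_(mu <- sM) ((bmax mu)%:Z - 1) =
      (\sum_(mu <- sM) bmax mu)%N%:Z - #|` sM|%:Z.
    rewrite sumrB -sum1_size -/sM; congr (_ - _).
      by rewrite (big_morph _ PoszD (erefl _)).
    by rewrite (big_morph _ PoszD (erefl _)).
  by rewrite cardE; lia.
Qed.
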